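(* Fix $\lambda\in\mathbb R$, $q\ge1$, a surplus vector $\mathbf r=(r_1,\dots,r_q)\in\mathbb Z_{\ge0}^q$, and $0<a<b<\infty$. Let $k_i=k_i(n)$ range over integers such that $x_i:=k_in^{-2/3}\in[a,b]$ for $1\le i\le q$. Then, as $n\to\infty$, uniformly over all $\mathbf k=(k_1,\dots,k_q)$ satisfying this constraint, $$L_{n,\lambda}(\mathbf k,\mathbf r)=n^{-2q/3}\,m_\lambda^{(q)}\bigl((x_1,r_1),\dots,(x_q,r_q)\bigr)(1+o(1)).$$ The estimate is also uniform when $\lambda$ ranges over a fixed compact interval.
   Context: For $\lambda\in\mathbb R$ put $p_{n,\lambda}=n^{-1}+\lambda n^{-4/3}$, with $n$ large enough that $p_{n,\lambda}\in(0,1)$. $G(n,p)$ is the Erdős–Rényi random graph, $\mathcal C(G)$ the set of connected components of $G$; for a component $C$, $|C|$ and $e(C)$ are its numbers of vertices and edges, and $\operatorname{sp}(C)=e(C)-|C|+1$. For integers $k_i\ge1$, $r_i\ge0$, $$L_{n,\lambda}(\mathbf k,\mathbf r)=\mathbb E\sum^{\ne}_{C_1,\dots,C_q\in\mathcal C(G(n,p_{n,\lambda}))}\prod_{i=1}^q\mathbf 1_{\{|C_i|=k_i,\ \operatorname{sp}(C_i)=r_i\}},$$ the sum over ordered $q$-tuples of distinct components. Let $c(k,m)$ be the number of connected labelled simple graphs on $k$ vertices with $m$ edges; the Wright constants $w_r>0$ are defined by $c(k,k+r-1)\sim w_rk^{k+3r/2-2}$ as $k\to\infty$ ($r\ge0$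 fixed). Put $F(x,\lambda)=\frac{x^3}{6}-\frac{\lambda x^2}{2}+\frac{\lambda^2x}{2}$, $\rho_r(x)=\frac{w_r}{\sqrt{2\pi}}x^{3r/2-5/2}$ for $x>0$, and $$m_\lambda^{(q)}\bigl((x_1,r_1),\dots,(x_q,r_q)\bigr)=\exp\Bigl\{-F\Bigl(\sum_{i=1}^qx_i,\lambda\Bigr)\Bigr\}\prod_{i=1}^q\rho_{r_i}(x_i).$$ *)

(* Defs.v *)
From HB Require Import structures.
From mathcomp Require Import all_boot all_order all_algebra.
From mathcomp Require Import all_classical all_reals all_analysis.

Set Implicit Arguments.
Unset Strict Implicit.
Unset Printing Implicit Defensive.

Import Order.TTheory GRing.Theory Num.Theory.
Import numFieldNormedType.Exports.

Local Open Scope classical_set_scope.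
Local Open Scope ring_scope.

(* A simple graph on the vertex type T is given by its edge set E, a set of
   two-element subsets of T. *)
Definition simple_graph (T : finType) (E : {set {set T}}) : bool :=
  [forall e in E, #|e| == 2].

Definition adj (T : finType) (E : {set {set T}}) : rel T :=
  fun u v => [set u; v]%SET \in E.

Definition connected_graph (T : finType) (E : {set {set T}}) : bool :=
  [forall u, forall v, connect (adj E) u v].

(* The set of vertex sets of the connected components. *)
Definition components (T : finType) (E : {set {set T}}) : {set {set T}} :=
  equivalence_partition (connect (adj E)) [set: T]%SET.

(* E ::&: C is the set of edges contained in C; when C is a component these are
   exactly the edges of that component. *)
Definition edges_in (T : finType) (E : {set {set T}}) (C : {set T}) : nat :=
  #|E ::&: C|.

Definition surplus (T : finType) (E : {set {set T}}) (C : {set T}) : int :=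
  (edges_in E C)%:Z - #|C|%:Z + 1.

(* Law of G(n, p): each pair is an edge with probability p, independently. *)
Definition gnp_prob (R : realType) (n : nat) (p : R) (E : {set {set 'I_n}}) : R :=
  \prod_(e : {set 'I_n} | #|e| == 2) (if e \in E then p else 1 - p).

Definition gnp_expectation (R : realType) (n : nat) (p : R)
    (X : {set {set 'I_n}} -> R) : R :=
  \sum_(E : {set {set 'I_n}} | simple_graph E) gnp_prob p E * X E.

Definition p_crit (R : realType) (n : nat) (lambda : R) : R :=
  n%:R^-1 + lambda * n%:R `^ (- (4 / 3)).

(* The inner sum ranges over injective maps from 'I_q to the components, i.e.
   over ordered q-tuples of distinct components. *)
Definition L (R : realType) (n : nat) (lambda : R) (q : nat)
    (k r : 'I_q -> nat) : R :=
  gnp_expectation (p_crit n lambda) (fun E : {set {set 'I_n}} =>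
    \sum_(C : {ffun 'I_q -> {set 'I_n}} |
          injectiveb C && [forall i, C i \in components E])
      \prod_(i < q) ((#|C i| == k i) && (surplus E (C i) == (r i)%:Z))%:R).

Definition num_connected (k m : nat) : nat :=
  #|[set E : {set {set 'I_k}} |
      [&& simple_graph E, connected_graph E & #|E| == m]]%SET|.

(* The truncated subtraction only matters at k = r = 0. *)
Definition wright_constants (R : realType) (w : nat -> R) : Prop :=
  forall r : nat, 0 < w r /\
    (fun k : nat => (num_connected k (k + r - 1))%:R : R) ~_\oo
    (fun k : nat => w r * k%:R `^ (k%:R + 3 * r%:R / 2 - 2)).

Definition F (R : realType) (x lambda : R) : R :=
  x ^+ 3 / 6 - lambda * x ^+ 2 / 2 + lambda ^+ 2 * x / 2.

Definition rho (R : realType) (w : nat -> R) (r : nat) (x : R) : R :=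
  w r / Num.sqrt (2 * pi) * x `^ (3 * r%:R / 2 - 5 / 2).

Definition m_density (R : realType) (w : nat -> R) (lambda : R) (q : nat)
    (x : 'I_q -> R) (r : 'I_q -> nat) : R :=
  expR (- F (\sum_(i < q) x i) lambda) * \prod_(i < q) rho w (r i) (x i).

Definition rescaled (R : realType) (n k : nat) : R :=
  k%:R * n%:R `^ (- (2 / 3)).

Definition L_limit (R : realType) (w : nat -> R) (n : nat) (lambda : R)
    (q : nat) (k r : 'I_q -> nat) : R :=
  n%:R `^ (- (2 * q%:R / 3)) *
    m_density w lambda (fun i => rescaled R n (k i)) r.

(* Main.v *)
Require Import Defs.
From HB Require Import structures.
From mathcomp Require Import all_boot all_order all_algebra.
From mathcomp Require Import all_classical all_reals all_analysis.
From mathcomp Require Import ring lra zify.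

Set Implicit Arguments.
Unset Strict Implicit.
Unset Printing Implicit Defensive.

Import Order.TTheory GRing.Theory Num.Theory.
Import numFieldNormedType.Exports.

Local Open Scope classical_set_scope.
Local Open Scope ring_scope.

(** The expectation has a closed form.  A q-tuple of distinct components of the
    prescribed sizes and surpluses amounts to a choice of disjoint vertex sets
    C_1, ..., C_q with |C_i| = k_i, of a connected graph with
    m_i = k_i + r_i - 1 edges on each C_i, and of no further edge touching their
    union; the pairs outside the union are free and contribute a factor 1.
    With K = sum k_i, M = sum m_i and D = 'C(n, 2) - 'C(n - K, 2) - M (the pairs
    touching the union that must be absent), and since there are
    n ^_ K / prod k_i`! ways of choosing the C_i,
      L = n ^_ K * prod (c(k_i, m_i) / k_i`!) * p ^ M * (1 - p) ^ D
    (lemmas [L_exact] and [count_disjoint_family]).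

    Each factor c(k, k + r - 1) / k`! is, by the definition of the Wright
    constant and Stirling's formula,
      w_r / sqrt (2 pi) * k ^ (3 r / 2 - 5 / 2) * e ^ k * (1 + o(1))
    as k tends to infinity ([connected_over_fact]).  Stirling's formula
    ([stirling]) is obtained from a telescoping bound for the existence of the
    limit and from Wallis' product for its value.

    The remaining factor n ^_ K * p ^ M * (1 - p) ^ D is expanded on the
    logarithmic scale ([log_weight_bound]).  Put h = n ^ (- 1 / 3) and
    x = K * h ^ 2, so that n = h ^ -3 and p = h ^ 3 * (1 + lambda * h).  To second
    order,
      ln (n ^_ K) = K ln n - K ^ 2 / (2 n) - K ^ 3 / (6 n ^ 2) + O(h),
      M ln (1 + lambda h) = x lambda / h - x lambda ^ 2 / 2 + O(h),
      D ln (1 - p) = - K - x lambda / h + x ^ 2 / (2 h) + lambda x ^ 2 / 2 + O(h).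
    All the terms of order 1 / h cancel, and what is left is
    (K - M) ln n - K - F(x, lambda) + O(h), with a constant depending only on
    bounds for x, |lambda| and |M - K|.  The factor e ^ (- K) is compensated by
    the factors e ^ (k_i), and the powers of n collect to n ^ (- 2 q / 3).

    Writing L as the limit expression times e ^ y with a uniformly small y
    ([L_eq_limit_expR]) keeps all the errors additive; the case of a fixed lambda
    is that of the interval [lambda, lambda]. *)

(** * Components of a graph *)

Section Components.
Import boot.fintype boot.fingraph boot.finset.
Local Open Scope nat_scope.
Local Open Scope set_scope.
Local Open Scope bool_scope.

Definition pairs_meeting (T : finType) (U : {set T}) : {set {set T}} :=
  [set e : {set T} | (#|e| == 2) && ~~ [disjoint e & U]].

Definition isolated (T : finType) (E : {set {set T}}) (C : {set T}) : bool :=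
  [forall e in E, [disjoint e & C] || (e \subset C)].

Definition connects (T : finType) (A : {set {set T}}) (C : {set T}) : bool :=
  [forall u in C, forall v in C, connect (adj A) u v].

Lemma adj_sym (T : finType) (E : {set {set T}}) : symmetric (adj E).
Proof. by move=> u v; rewrite /adj setUC. Qed.

Lemma connect_adj_equiv (T : finType) (E : {set {set T}}) :
  {in [set: T] & &, equivalence_rel (connect (adj E))}.
Proof.
have sE : connect_sym (adj E) by apply: sym_connect_sym; apply: adj_sym.
move=> x y z _ _ _; split => [|xy]; first exact: connect0.
by apply/idP/idP; apply: connect_trans; rewrite // sE.
Qed.

Lemma isolated_closed (T : finType) (E : {set {set T}}) (C : {set T}) :
  isolated E C -> closed (adj E) C.
Proof.
move=> /forallP iE.
have sE : connect_sym (adj E) by apply: sym_connect_sym; apply: adj_sym.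
apply: intro_closed => // x y xy xC; have := implyP (iE _) xy.
case/orP => [/disjointFr/(_ (set21 x y))|/subsetP/(_ y)]; first by rewrite xC.
by apply; rewrite set22.
Qed.

(** A path of E starting in an isolated set never leaves it, so it is a path of
    the induced graph. *)
Lemma connect_in_isolated (T : finType) (E : {set {set T}}) (C : {set T}) u v :
  isolated E C -> u \in C -> connect (adj E) u v ->
  connect (adj (E ::&: C)) u v.
Proof.
move=> /isolated_closed clC uC /connectP[p]; elim: p u uC => [|x p IHp] u uC /=.
  by move=> _ ->; apply: connect0.
case/andP=> ux px vp; have xC : x \in C by rewrite -(clC _ _ ux).
apply: connect_trans (IHp _ xC px vp); apply: connect1.
by move: ux; rewrite /adj inE subUset !sub1set uC xC => ->.
Qed.

(** Components are described by conditions on the trace of the graph on the pairs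
    touching C; this locality is what makes their probabilities factorize. *)
Lemma mem_components (T : finType) (E : {set {set T}}) (C : {set T}) :
  simple_graph E ->
  (C \in components E) = [&& C != set0, isolated E C & connects (E ::&: C) C].
Proof.
move=> /forallP sE; apply/imsetP/and3P => [[x _ ->]|[/set0Pn[x xC] iE /forallP cE]].
  have eqE : connect_sym (adj E) by apply: sym_connect_sym; apply: adj_sym.
  have iC : isolated E [set y in [set: T] | connect (adj E) x y].
    apply/forallP => e; apply/implyP => eE.
    have [//|/pred0Pn[z /= /andP[ze]]] := boolP [disjoint _ & _].
    rewrite !inE /= => xz; apply/subsetP => t te; rewrite !inE /=.
    have [<-//|zt] := eqVneq z t; apply: connect_trans xz (connect1 _).
    rewrite /adj -[X in X \in _](_ : e = _) //; apply/eqP.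
    rewrite eq_sym eqEcard subUset !sub1set ze te cards2 zt.
    by rewrite (eqP (implyP (sE e) eE)).
  split=> //; first by apply/set0Pn; exists x; rewrite !inE connect0.
  apply/forallP => u; apply/implyP => uC; apply/forallP => v; apply/implyP => vC.
  apply: connect_in_isolated => //; move: uC vC; rewrite !inE /= eqE.
  exact: connect_trans.
exists x => //; apply/setP => y; rewrite !inE /=; apply/idP/idP => [yC|xy].
  have /forallP/(_ y)/implyP/(_ yC) := implyP (cE x) xC.
  apply: connect_sub => {yC} s t; rewrite /adj inE => /andP[xy _].
  exact: connect1.
by rewrite -(closed_connect (isolated_closed iE) xy).
Qed.

Lemma card_pairs_meeting (T : finType) (U : {set T}) :
  #|pairs_meeting U| = 'C(#|T|, 2) - 'C(#|T| - #|U|, 2).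
Proof.
have <- : #|~: U| = #|T| - #|U| by rewrite cardsCs setCK.
rewrite -cards_draws -card_draws -cardsDS; last first.
  by apply/subsetP => e; rewrite !inE => /andP[].
apply: eq_card => e; rewrite !inE disjoints_subset.
by case: (#|e| == 2); rewrite ?andbF ?andbT.
Qed.

End Components.

(** * Connected graphs on a vertex subset *)

Section Relabelling.
Import boot.fintype boot.fingraph boot.finset.
Local Open Scope nat_scope.
Local Open Scope set_scope.
Local Open Scope bool_scope.

Definition connected_on (T : finType) (C : {set T}) (m : nat) :
    {set {set {set T}}} :=
  [set A : {set {set T}} |
    [&& A \subset [set e : {set T} | (#|e| == 2) && (e \subset C)],
        connects A C & #|A| == m]].

Definition relabel (S T : finType) (f : S -> T) (E : {set {set S}}) :
    {set {set T}} :=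
  [set f @: e | e : {set S} in E].

Lemma adj_relabel (S T : finType) (f : S -> T) (E : {set {set S}}) u v :
  injective f -> adj (relabel f E) (f u) (f v) = adj E u v.
Proof.
move=> fI; rewrite /adj -imset_set1 -imset_set1 -imsetU.
by rewrite (mem_imset _ _ (imset_inj fI)).
Qed.

Lemma connect_relabel (S T : finType) (f : S -> T) (E : {set {set S}}) u v :
  injective f ->
  connect (adj (relabel f E)) (f u) (f v) = connect (adj E) u v.
Proof.
move=> fI; apply/idP/idP => /connectP[p].
  elim: p u => [|y p IHp] u /=; first by move=> _ /fI ->; apply: connect0.
  case/andP=> uy py vp.
  have /imsetP[e _ ey] := uy.
  have : y \in f @: e by rewrite -ey set22.
  case/imsetP=> x _ yx; rewrite yx in uy py vp.
  apply: connect_trans (IHp x py vp); apply: connect1.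
  by rewrite adj_relabel in uy.
elim: p u => [|y p IHp] u /=; first by move=> _ ->; apply: connect0.
case/andP=> uy py vp; apply: connect_trans (IHp y py vp).
by apply: connect1; rewrite adj_relabel.
Qed.

(** The enumeration of C transports labelled graphs on 'I_#|C| bijectively to
    graphs on C. *)
Lemma card_connected_on (T : finType) (C : {set T}) (m : nat) :
  #|connected_on C m| = num_connected #|C| m.
Proof.
pose f : 'I_#|C| -> T := @enum_val T (mem C).
have fI : injective f := @enum_val_inj _ _.
have fC i : f i \in C := enum_valP i.
have Cf x : x \in C -> exists i, x = f i.
  by move=> xC; exists (enum_rank_in xC x); rewrite /f enum_rankK_in.
have phiI : injective (relabel f) := imset_inj (imset_inj fI).
rewrite /num_connected -(card_imset _ phiI); apply: eq_card => A.
have connE E : connects (relabel f E) C = connected_graph E.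
  apply/forallP/forallP => [cE i|cE u].
    apply/forallP => j; rewrite -(connect_relabel _ _ _ fI).
    by have /implyP/(_ (fC i))/forallP/(_ (f j))/implyP/(_ (fC j)) := cE (f i).
  apply/implyP => /Cf[i ->]; apply/forallP => v; apply/implyP => /Cf[j ->].
  by rewrite connect_relabel //; apply: (forallP (cE i)).
rewrite inE; apply/and3P/imsetP => [[/subsetP sA cA mA]|[E]].
  pose E := [set e : {set 'I_#|C|} | f @: e \in A].
  have AE : A = relabel f E.
    apply/setP => e; apply/idP/imsetP => [eA|[d]]; last by rewrite inE => + ->.
    have eE : e = f @: (f @^-1: e).
      apply/setP => x; apply/idP/imsetP => [xe|[i]]; last by rewrite inE => + ->.
      have := sA _ eA; rewrite inE => /andP[_ /subsetP/(_ _ xe)] /Cf[i xi].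
      by exists i => //; rewrite inE -xi.
    by exists (f @^-1: e) => //; rewrite inE -eE.
  exists E => //; rewrite inE -connE -AE cA.
  rewrite -(card_imset _ (imset_inj fI)) -/(relabel f E) -AE mA /= andbT.
  apply/forallP => e; apply/implyP; rewrite inE => /sA.
  by rewrite inE card_imset // => /andP[].
rewrite inE => /and3P[/forallP sE cE mE] ->; rewrite connE.
rewrite (card_imset _ (imset_inj fI)); split=> //.
apply/subsetP => _ /imsetP[e eE ->]; rewrite inE card_imset //.
rewrite (implyP (sE e) eE) /=; apply/subsetP => _ /imsetP[i _ ->]; exact: fC.
Qed.

End Relabelling.

(** * Counting families of disjoint sets *)

Section Counting.
Import boot.fintype boot.fingraph boot.finset.
Local Open Scope nat_scope.
Local Open Scope set_scope.
Local Open Scope bool_scope.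

Lemma card_disjoint_bigcup (T I : finType) (F : I -> {set T}) :
  (forall i j, i != j -> [disjoint F i & F j]) ->
  #|\bigcup_i F i| = (\sum_i #|F i|)%N.
Proof.
move=> dF; rewrite -sum1_card (partition_disjoint_bigcup _ _ dF).
by apply: eq_bigr => i _; rewrite sum1_card.
Qed.

Definition disjoint_family (T I : finType) (C : I -> {set T}) : bool :=
  [forall i, forall j, (i != j) ==> [disjoint C i & C j]].

Lemma ffactD n a b : n ^_ (a + b) = n ^_ a * (n - a) ^_ b.
Proof.
elim: b => [|b IHb]; first by rewrite addn0 muln1.
by rewrite addnS !ffactnSr IHb -mulnA subnDA.
Qed.

(** The multinomial count, in a division-free form.  The induction adds one index
    at a time: once the other sets are chosen, C i is any subset of size k i of
    the complement of their union.  Indices still to be treated carry the empty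
    set. *)
Lemma count_disjoint_family (T : finType) (q : nat) (k : 'I_q -> nat) :
  #|[set C : {ffun 'I_q -> {set T}} |
      disjoint_family C && [forall i, #|C i| == k i]]| * \prod_i (k i)`!
    = #|T| ^_ (\sum_i k i).
Proof.
pose N (s : seq 'I_q) := [set C : {ffun 'I_q -> {set T}} |
   disjoint_family C && [forall i, #|C i| == (if i \in s then k i else 0)]].
suff H s : uniq s ->
    #|N s| * \prod_(i <- s) (k i)`! = #|T| ^_ (\sum_(i <- s) k i).
  have -> : \prod_i (k i)`! = \prod_(i <- enum 'I_q) (k i)`! by rewrite big_enum.
  have -> : \sum_i k i = \sum_(i <- enum 'I_q) k i by rewrite big_enum.
  rewrite -H ?enum_uniq //.
  congr (_ * _); apply: eq_card => C; rewrite !inE; congr andb.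
  by apply: eq_forallb => i; rewrite mem_enum.
elim: s => [_|i s IHs /= /andP[iNs us]].
  rewrite !big_nil muln1 ffactn0 (_ : N [::] = [set [ffun=> set0]]) ?cards1 //.
  apply/setP => C; rewrite !inE; apply/andP/eqP => [[_ /forallP C0] | ->].
    by apply/ffunP => j; rewrite ffunE; apply/eqP; rewrite -cards_eq0 C0.
  split; last by apply/forallP => j; rewrite ffunE cards0.
  apply/forallP => a; apply/forallP => b; apply/implyP => _.
  by rewrite !ffunE -setI_eq0 set0I.
(* The families over i :: s are fibred over those over s by emptying the i-th set. *)
pose del (C : {ffun 'I_q -> {set T}}) : {ffun 'I_q -> {set T}} :=
  [ffun j => if j == i then set0 else C j].
pose ins (C : {ffun 'I_q -> {set T}}) (B : {set T}) : {ffun 'I_q -> {set T}} :=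
  [ffun j => if j == i then B else C j].
set n := \sum_(j <- s) k j in IHs *.
suff -> : #|N (i :: s)| = #|N s| * 'C(#|T| - n, k i).
  rewrite !big_cons (addnC (k i)) ffactD -/n -IHs // -bin_ffact.
  by rewrite (mulnC (k i)`!) mulnACA.
have NsE C : C \in N s -> #|\bigcup_j C j| = n /\ C i = set0.
  rewrite inE => /andP[/forallP dC /forallP cC].
  split; last by apply/eqP; rewrite -cards_eq0 (eqP (cC i)) (negbTE iNs).
  rewrite card_disjoint_bigcup; last first.
    by move=> a b ab; have /forallP/(_ b)/implyP/(_ ab) := dC a.
  rewrite /n [RHS]big_uniq // [RHS]big_mkcond /=.
  by apply: eq_bigr => j _; rewrite (eqP (cC j)).
have delN C : C \in N (i :: s) -> del C \in N s.
  rewrite !inE => /andP[/forallP dC /forallP cC]; apply/andP; split.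
    apply/forallP => a; apply/forallP => b; apply/implyP => ab; rewrite !ffunE.
    case: eqP => _; first by rewrite -setI_eq0 set0I.
    case: eqP => _; first by rewrite -setI_eq0 setI0.
    by have /forallP/(_ b)/implyP/(_ ab) := dC a.
  apply/forallP => j; rewrite ffunE.
  have [->|ji] := eqVneq j i; first by rewrite cards0 (negbTE iNs).
  by have := cC j; rewrite inE (negbTE ji).
rewrite -sum1_card (partition_big del (mem (N s))) => [|C CN]; last exact: delN.
rewrite -sum_nat_const; apply: eq_bigr => C CN; rewrite sum1dep_card.
have [nC Ci] := NsE _ CN.
have <- : #|~: \bigcup_j C j| = #|T| - n by rewrite cardsCs setCK nC.
rewrite -cards_draws -(card_in_imset (f := ins C)); last first.
  by move=> A B _ _ /ffunP/(_ i); rewrite !ffunE eqxx.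
apply: eq_card => D; rewrite [LHS]in_set; apply/andP/imsetP => [[DN /eqP dD]|[B]].
  exists (D i).
    rewrite !inE in DN *; have /andP[/forallP dDs /forallP cD] := DN.
    apply/andP; split; last by have := cD i; rewrite inE eqxx.
    rewrite -disjoints_subset; apply: bigcup_disjoint => j _.
    rewrite -dD ffunE; have [_|ji] := eqVneq j i; first by rewrite -setI_eq0 setI0.
    by have /forallP/(_ j)/implyP := dDs i; apply; rewrite eq_sym.
  by apply/ffunP => j; rewrite ffunE -dD ffunE; case: eqP => [->|].
rewrite inE -disjoints_subset => /andP[/bigcup_disjointP dB cB] ->.
have: C \in N s := CN; rewrite inE => /andP[/forallP dC /forallP cC].
split; last first.
  by apply/eqP/ffunP => j; rewrite !ffunE; case: eqP => [->|].
rewrite inE; apply/andP; split.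
  apply/forallP => a; apply/forallP => b; apply/implyP; rewrite !ffunE.
  have [ai|ai] := eqVneq a i; have [bi|bi] := eqVneq b i.
  - by rewrite ai bi eqxx.
  - by move=> _; apply: dB.
  - by move=> _; rewrite disjoint_sym; apply: dB.
  - by move=> ab; have /forallP/(_ b)/implyP/(_ ab) := dC a.
apply/forallP => j; rewrite ffunE inE; have [->//|ji] := eqVneq j i.
exact: cC.
Qed.

End Counting.

(** * The exact formula for the expectation *)

Section ExactFormula.
Import boot.fintype boot.fingraph boot.finset.
Local Open Scope set_scope.
Local Open Scope bool_scope.

(** Disjoint unions of connected graphs on the C i with m i edges: the traces that
    a graph having the C i as components may leave on the pairs meeting their
    union. *)
Definition union_graphs (T I : finType) (C : I -> {set T}) (m : I -> nat) :
    {set {set {set T}}} :=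
  [set D : {set {set T}} |
    (D == \bigcup_i (D ::&: C i)) &&
    [forall i, (D ::&: C i) \in connected_on (C i) (m i)]].

(** An edge inside two disjoint sets would be empty. *)
Lemma disjoint_edges (T I : finType) (C : I -> {set T}) (e : {set T}) i j :
  disjoint_family C -> #|e| == 2 -> e \subset C i -> e \subset C j -> i = j.
Proof.
move=> /forallP dC e2 ei ej; apply/eqP; apply: contraTT e2 => ij.
have /forallP/(_ j)/implyP/(_ ij) := dC i.
rewrite -setI_eq0 => /eqP CC.
have : e \subset C i :&: C j by rewrite subsetI ei ej.
by rewrite CC subset0 => /eqP ->; rewrite cards0.
Qed.

Lemma card_union_graphs (T I : finType) (C : I -> {set T}) (m : I -> nat) :
  disjoint_family C ->
  #|union_graphs C m| = \prod_i #|connected_on (C i) (m i)|.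
Proof.
move=> dC.
have -> : \prod_i #|connected_on (C i) (m i)| =
    #|family (fun i => mem (connected_on (C i) (m i)))|.
  under eq_bigr do rewrite -sum1_card.
  by rewrite bigA_distr_big_dep -sum1_card; apply: eq_bigr => f _; rewrite big1.
pose split D : {ffun I -> {set {set T}}} := [ffun i => D ::&: C i].
rewrite -(card_in_imset (f := split)) => [|D D']; last first.
  rewrite !inE => /andP[/eqP DE _] /andP[/eqP DE' _] /ffunP sDD.
  rewrite DE DE'; apply: eq_bigr => i _.
  by have := sDD i; rewrite !ffunE.
apply: eq_card => f; apply/imsetP/familyP => [[D]|fC].
  by rewrite inE => /andP[_ /forallP cD] -> i; rewrite ffunE; apply: cD.
have fe i e : e \in f i -> #|e| == 2 /\ e \subset C i.
  move=> ef; have : f i \in connected_on (C i) (m i) := fC i.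
  by rewrite inE => /and3P[/subsetP/(_ e ef) + _ _]; rewrite inE => /andP.
have fD i : (\bigcup_j f j) ::&: C i = f i.
  apply/setP => e; rewrite inE; apply/andP/idP => [[/bigcupP[j _ ej] ei]|ei].
    have [e2 eCj] := fe _ _ ej.
    by rewrite (disjoint_edges dC e2 ei eCj).
  by have [_ ->] := fe _ _ ei; split=> //; apply/bigcupP; exists i.
exists (\bigcup_j f j); last by apply/ffunP => i; rewrite ffunE fD.
have UE : \bigcup_i ((\bigcup_j f j) ::&: C i) = \bigcup_j f j.
  by apply: eq_bigr => i _; apply: fD.
rewrite in_set UE eqxx /=.
by apply/forallP => i; rewrite fD; apply: fC.
Qed.

Lemma card_union_graph (T I : finType) (C : I -> {set T}) (m : I -> nat) D :
  disjoint_family C -> D \in union_graphs C m -> #|D| = (\sum_i m i)%N.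
Proof.
move=> dC; rewrite inE => /andP[/eqP DE /forallP cD].
rewrite DE card_disjoint_bigcup => [|i j ij].
  by apply: eq_bigr => i _; have := cD i; rewrite inE => /and3P[_ _ /eqP].
rewrite -setI_eq0; apply/set0Pn => -[e]; rewrite !inE => /andP[/andP[eD ei]].
move=> /andP[_ ej]; move/eqP: ij; apply.
apply: (disjoint_edges dC _ ei ej).
have := cD i; rewrite inE => /and3P[/subsetP/(_ e) + _ _].
by rewrite !inE eD ei => /(_ isT)/andP[].
Qed.

Lemma union_graph_meeting (T I : finType) (C : I -> {set T}) (m : I -> nat) D :
  D \in union_graphs C m -> D \subset pairs_meeting (\bigcup_i C i).
Proof.
rewrite inE => /andP[/eqP DE /forallP cD]; apply/subsetP => e.
rewrite DE => /bigcupP[i _ eD]; rewrite inE.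
have := cD i; rewrite inE => /and3P[/subsetP/(_ e eD) + _ _].
rewrite !inE => /andP[e2 eC]; rewrite e2 /=.
have /set0Pn[x xe] : e != set0 by rewrite -cards_eq0 (eqP e2).
apply/pred0Pn; exists x; rewrite /= xe /=.
by apply/bigcupP; exists i => //; apply: (subsetP eC).
Qed.

(** Distinct components are disjoint, and isolation of every C i says that the
    trace has no edge besides those inside the C i. *)
Lemma components_trace (T I : finType) (E : {set {set T}}) (C : I -> {set T})
    (m : I -> nat) :
  simple_graph E -> (forall i, C i != set0) ->
  [&& injectiveb C, [forall i, C i \in components E] &
      [forall i, #|E ::&: C i| == m i]] =
  disjoint_family C &&
  (E :&: pairs_meeting (\bigcup_i C i) \in union_graphs C m).
Proof.
move=> sE C0; set Q := pairs_meeting _.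
have E2 e : e \in E -> #|e| == 2 by move=> eE; apply: (implyP (forallP sE e)).
have meet e i x : e \in E -> x \in e -> x \in C i -> e \in Q.
  move=> eE xe xi; rewrite inE E2 //=; apply/pred0Pn; exists x.
  by rewrite /= xe; apply/bigcupP; exists i.
have EQ i : (E :&: Q) ::&: C i = E ::&: C i.
  apply/setP => e; rewrite [LHS]in_set [RHS]in_set in_setI.
  have [eE|//] := boolP (e \in E).
  have [eC|] := boolP (e \subset C i); last by rewrite !andbF.
  have /set0Pn[x xe] : e != set0 by rewrite -cards_eq0 (eqP (E2 _ eE)).
  by rewrite (meet _ i x) // (subsetP eC).
have sub i : E ::&: C i \subset [set e : {set T} | (#|e| == 2) && (e \subset C i)].
  by apply/subsetP => e; rewrite !in_set => /andP[eE ->]; rewrite E2.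
apply/and3P/andP.
  case=> /injectiveP CI /forallP CE /forallP mE.
  have CE' i := CE i; rewrite /= in CE'.
  split.
    apply/forallP => i; apply/forallP => j; apply/implyP => ij.
    have /and3P[_ /trivIsetP tE _] := equivalence_partitionP (connect_adj_equiv E).
    by apply: tE => //; apply: contra ij => /eqP/CI ->.
  rewrite in_set; apply/andP; split; last first.
    apply/forallP => i; rewrite EQ in_set sub mE andbT /=.
    by have := CE i; rewrite mem_components // => /and3P[].
  apply/eqP/setP => e; apply/idP/bigcupP => [|[i _]]; last by rewrite inE => /andP[].
  rewrite !inE => /and3P[eE e2 /pred0Pn[x /= /andP[xe /bigcupP[i _ xi]]]].
  have := CE i; rewrite mem_components // => /and3P[_ /forallP/(_ e) + _].
  rewrite eE /= => /orP[/disjointFr/(_ xe)|eC]; first by rewrite xi.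
  exists i => //; rewrite EQ inE eE eC //.
case=> dC; rewrite in_set => /andP[/eqP QE /forallP cQ].
split; last first.
- by apply/forallP => i; have := cQ i; rewrite EQ in_set => /and3P[].
- apply/forallP => i; rewrite mem_components // C0 /=.
  have := cQ i; rewrite EQ in_set => /and3P[_ -> _]; rewrite andbT.
  apply/forallP => e; apply/implyP => eE.
  have [//|/pred0Pn[x /= /andP[xe xi]]] := boolP [disjoint _ & _].
  have : e \in E :&: Q by rewrite inE eE (meet _ i x).
  rewrite QE => /bigcupP[j _]; rewrite inE => /andP[_ ej].
  suff -> : i = j by [].
  apply: contraTeq xi => ij.
  move/forallP/(_ j)/forallP/(_ i)/implyP: dC; rewrite eq_sym => /(_ ij).
  by move/disjointFr => -> //; apply: (subsetP ej).
- apply/injectiveP => i j Cij; apply: contraTeq (C0 i) => ij.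
  move/forallP/(_ i)/forallP/(_ j)/implyP/(_ ij): dC.
  by rewrite -Cij -setI_eq0 setIid negbK.
Qed.

Lemma prodr_nat_bool (R : realType) (I : finType) (b : I -> bool) :
  \prod_i ((b i)%:R : R) = [forall i, b i]%:R.
Proof.
have [/forallP bT|/forallPn[i /negbTE bF]] := boolP [forall i, b i].
  by rewrite big1 // => i _; rewrite bT.
by rewrite (bigD1 i) //= bF mul0r.
Qed.

(** The pairs outside Q sum out: expanding a product of sums over all sets E, the
    weights f (for a pair in E) and g (for a pair not in E) are set to 0 wherever
    E would fail to be a simple graph with trace D.  This is an identity of
    polynomials in p. *)
Lemma gnp_prob_trace (R : realType) (n : nat) (p : R) (Q D : {set {set 'I_n}}) :
  D \subset Q -> Q \subset [set e : {set 'I_n} | #|e| == 2] ->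
  \sum_(E : {set {set 'I_n}} | simple_graph E && (E :&: Q == D)) gnp_prob p E =
  p ^+ #|D| * (1 - p) ^+ (#|Q| - #|D|).
Proof.
move=> /subsetP DQ /subsetP Q2.
pose f (e : {set 'I_n}) : R :=
  if #|e| == 2 then if e \in Q then (if e \in D then p else 0) else p else 0.
pose g (e : {set 'I_n}) : R :=
  if #|e| == 2 then if e \in Q then (if e \in D then 0 else 1 - p) else 1 - p
  else 1.
transitivity (\sum_(E : {set {set 'I_n}}) \prod_e (if e \in E then f e else g e)).
  rewrite big_mkcond /=; apply: eq_bigr => E _.
  case: ifP => [/andP[/forallP sE /eqP EQ]|].
    rewrite /gnp_prob big_mkcond /=; apply: eq_bigr => e _; rewrite /f /g.
    case: ifP => e2; last first.
      by case: ifP => // eE; have := sE e; rewrite eE e2.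
    have [eQ|//] := boolP (e \in Q).
    have -> : (e \in D) = (e \in E) by rewrite -EQ inE eQ andbT.
    by case: (e \in E).
  move/negbT; rewrite negb_and => /orP[/forallPn[e]|].
    rewrite negb_imply => /andP[eE e2].
    by rewrite (bigD1 e) //= eE /f (negbTE e2) mul0r.
  move=> /eqP/setP; case/boolP: [forall e, (e \in E :&: Q) == (e \in D)].
    by move=> /forallP EQ; case=> e; apply/eqP.
  move=> /forallPn[e]; rewrite inE => eED _; rewrite (bigD1 e) //= /f /g.
  suff [eQ ->] : e \in Q /\ (e \in D) = (e \notin E).
    have := Q2 _ eQ; rewrite inE eQ => ->.
    by case: (e \in E); rewrite mul0r.
  have [eQ|eQ] := boolP (e \in Q); last first.
    move: eED; rewrite (negbTE eQ) andbF; case: (boolP (e \in D)) => [/DQ|//].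
    by rewrite (negbTE eQ).
  by split=> //; move: eED; rewrite eQ andbT; case: (e \in E); case: (e \in D).
rewrite -(bigA_distr _ _ f g).
transitivity (\prod_(e in Q) (if e \in D then p else 1 - p)).
  rewrite [RHS]big_mkcond /=; apply: eq_bigr => e _; rewrite /f /g.
  have [eQ|eQ] := boolP (e \in Q).
    have := Q2 _ eQ; rewrite inE => ->.
    by case: ifP => _; rewrite ?addr0 ?add0r.
  by case: ifP => _; rewrite ?add0r // addrC subrK.
rewrite (bigID (mem D)) /=; congr (_ * _).
  rewrite -prodr_const; apply: congr_big => // e; last by move=> /andP[_ ->].
  by case: (boolP (e \in D)) => [/DQ ->|]; rewrite ?andbF.
rewrite -cardsDS; last exact/subsetP.
rewrite -prodr_const; apply: congr_big => // e; first by rewrite !inE andbC.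
by move=> /andP[_ /negbTE ->].
Qed.

Lemma surplus_eqE (T : finType) (E : {set {set T}}) (C : {set T}) (k r : nat) :
  (0 < k)%N -> #|C| = k ->
  (surplus E C == r%:Z) = (#|E ::&: C| == (k + r - 1)%N).
Proof. by rewrite /surplus /edges_in => k0 ->; apply/eqP/eqP; lia. Qed.

Lemma tuple_indicator (T : finType) (E : {set {set T}}) (q : nat)
    (C : {ffun 'I_q -> {set T}}) (k r : 'I_q -> nat) :
  simple_graph E -> (forall i, 0 < k i)%N ->
  (injectiveb C && [forall i, C i \in components E]) &&
    [forall i, (#|C i| == k i) && (surplus E (C i) == (r i)%:Z)] =
  (disjoint_family C && [forall i, #|C i| == k i]) &&
    (E :&: pairs_meeting (\bigcup_i C i) \in
       union_graphs C (fun i => k i + r i - 1)%N).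
Proof.
move=> sE k0; have [/forallP kC|kC] := boolP [forall i, #|C i| == k i].
  rewrite andbT -components_trace // => [|i]; last first.
    by rewrite -cards_eq0 (eqP (kC i)) -lt0n.
  rewrite -andbA; congr [&& _, _ & _]; apply: eq_forallb => i.
  by rewrite (surplus_eqE _ _ (k0 i) (eqP (kC i))) kC.
rewrite andbF; apply/negbTE; apply: contra kC => /andP[_ /forallP kC].
by apply/forallP => i; have /andP[] := kC i.
Qed.

(** Summing over the possible traces: by [card_union_graph] every union graph of
    every admissible family C has the same number of edges, hence the same
    weight. *)
Theorem L_exact (R : realType) (n : nat) (lambda : R) (q : nat)
    (k r : 'I_q -> nat) :
  (forall i, 0 < k i)%N ->
  L n lambda k r =
  #|[set C : {ffun 'I_q -> {set 'I_n}} |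
      disjoint_family C && [forall i, #|C i| == k i]]|%:R *
  (\prod_i (num_connected (k i) (k i + r i - 1))%:R) *
  (p_crit n lambda ^+ (\sum_i (k i + r i - 1)) *
   (1 - p_crit n lambda) ^+
     ('C(n, 2) - 'C(n - \sum_i k i, 2) - \sum_i (k i + r i - 1))).
Proof.
move=> k0; rewrite /L /gnp_expectation; set p := p_crit n lambda.
pose m i := (k i + r i - 1)%N.
set V := [set C : {ffun 'I_q -> {set 'I_n}} | _].
transitivity (\sum_(C : {ffun 'I_q -> {set 'I_n}} | C \in V)
    \sum_(E : {set {set 'I_n}} | simple_graph E &&
       (E :&: pairs_meeting (\bigcup_i C i) \in union_graphs C m))
    gnp_prob p E).
  under eq_bigr => E _ do rewrite big_distrr big_mkcond /=.
  rewrite exchange_big /= [RHS]big_mkcond; apply: eq_bigr => C _.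
  transitivity (\sum_(E : {set {set 'I_n}} | simple_graph E)
     if (C \in V) && (E :&: pairs_meeting (\bigcup_i C i) \in union_graphs C m)
     then gnp_prob p E else 0).
    apply: eq_bigr => E sE; rewrite prodr_nat_bool in_set -tuple_indicator //.
    by case: (_ && _); case: [forall i, _]; rewrite ?mulr1 ?mulr0.
  by case: ifP => CV; [rewrite big_mkcondr | rewrite big1].
rewrite -mulrA mulr_natl -sumr_const; apply: eq_bigr => C.
rewrite inE => /andP[dC /forallP kC].
rewrite (partition_big (fun E => E :&: pairs_meeting (\bigcup_i C i))
           (mem (union_graphs C m))) => [|E /andP[]//].
rewrite /=; transitivity (\sum_(D in union_graphs C m)
    (p ^+ (\sum_i m i)%N * (1 - p) ^+ ('C(n, 2) - 'C(n - \sum_i k i, 2) - \sum_i m i)%N)).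
  apply: eq_bigr => D DG; rewrite -(card_union_graph dC DG).
  have -> : ('C(n, 2) - 'C(n - \sum_i k i, 2) =
             #|pairs_meeting (\bigcup_i C i)|)%N.
    rewrite card_pairs_meeting card_ord card_disjoint_bigcup; last first.
      by move=> i j ij; have /forallP/(_ i)/forallP/(_ j)/implyP/(_ ij) := dC.
    by congr (_ - 'C(_ - _, _))%N; apply: eq_bigr => i _; rewrite (eqP (kC i)).
  rewrite -gnp_prob_trace; first last.
  - by apply/subsetP => e; rewrite !inE => /andP[].
  - exact: union_graph_meeting DG.
  apply: eq_bigl => E; rewrite -andbA; congr andb.
  by case: eqP => [->|]; rewrite ?andbF // DG.
rewrite sumr_const (card_union_graphs _ dC) -mulr_natl natr_prod.
congr (_ * _); apply: eq_bigr => i _.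
by rewrite card_connected_on (eqP (kC i)).
Qed.

End ExactFormula.

(** * Taylor bounds for the logarithm *)

(** Mean value theorem for f y = ln y + y ^ 2 / 2 - 2 y, whose derivative is
    (y - 1) ^ 2 / y and for which f (1 + t) - f 1 is the quantity to bound. *)
Lemma ln1D_taylor2 (R : realType) (t : R) :
  `|t| <= 1 / 2 -> `|ln (1 + t) - t + t ^+ 2 / 2| <= 2 * `|t| ^+ 3.
Proof.
pose f : R -> R := @ln R + (2^-1 *: (id : R -> R) ^+ 2 - 2 *: (id : R -> R)).
pose f' (y : R) : R := (y - 1) ^+ 2 / y.
have fd (y : R) : 0 < y -> is_derive y 1 f (f' y).
  move=> y0.
  have D := is_deriveD (is_derive1_ln y0)
    (is_deriveB (is_deriveZ 2^-1 (is_deriveX 2 (is_derive_id y (1 : R))))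
       (is_deriveZ 2 (is_derive_id y (1 : R)))).
  apply: (is_derive_eq D); rewrite /f' /GRing.scale /=; field.
  by rewrite gt_eqF.
have fE y : f y = ln y + (2^-1 * y ^+ 2 - 2 * y) by [].
have f'le c : 1 / 2 <= c -> `|c - 1| <= `|t| -> `|f' c| <= 2 * `|t| ^+ 2.
  move=> c2 ct; rewrite /f' normrM normfV normrX.
  rewrite [X in _ / X]ger0_norm; last by lra.
  rewrite ler_pdivrMr; last by lra.
  have : `|c - 1| ^+ 2 <= `|t| ^+ 2 by rewrite ler_sqr ?nnegrE.
  have : 0 <= `|t| ^+ 2 by rewrite exprn_ge0.
  by nra.
rewrite ler_norml => /andP[t1 t2].
have -> : ln (1 + t) - t + t ^+ 2 / 2 = f (1 + t) - f 1.
  by rewrite !fE ln1; field.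
suff [c [c2 ct ->]] : exists c, [/\ 1 / 2 <= c, `|c - 1| <= `|t| &
    f (1 + t) - f 1 = f' c * t].
  by rewrite normrM (exprS _ 2) mulrCA mulrC ler_wpM2l // f'le.
have fmvt a b : 0 < a -> a <= b ->
    exists2 c, c \in `[a, b]%R & f b - f a = f' c * (b - a).
  move=> a0 ab; have fd' y : y \in `]a, b[%R -> is_derive y 1 f (f' y).
    by rewrite in_itv /= => /andP[ay _]; apply: fd; apply: lt_trans ay.
  suff fc : {within `[a, b], continuous f} by exact: (MVT_segment ab fd' fc).
  apply: derivable_within_continuous => y; rewrite in_itv /= => /andP[ay _].
  by have [] := fd y (lt_le_trans a0 ay).
have [t0|t0] := lerP 0 t.
  have [|c] := fmvt 1 (1 + t) ltr01; first by lra.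
  rewrite in_itv /= => /andP[c1 c2] fc; exists c; split; first by lra.
    have := ler_norm t; have := ler_norm (- t); rewrite normrN ler_norml => ? ?.
    by apply/andP; split; lra.
  by rewrite fc; congr (_ * _); lra.
have [||c] := fmvt (1 + t) 1; [lra|lra|].
rewrite in_itv /= => /andP[c1 c2] fc; exists c; split; first by lra.
  have := ler_norm t; have := ler_norm (- t); rewrite normrN ler_norml => ? ?.
  by apply/andP; split; lra.
by rewrite -opprB fc; lra.
Qed.

Lemma ln1D_taylor1 (R : realType) (t : R) :
  `|t| <= 1 / 2 -> `|ln (1 + t) - t| <= 2 * t ^+ 2.
Proof.
move=> t2; have H := ln1D_taylor2 t2.
have -> : ln (1 + t) - t = (ln (1 + t) - t + t ^+ 2 / 2) - t ^+ 2 / 2 by ring.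
apply: le_trans (ler_normB _ _) _; apply: le_trans (lerD H (lexx _)) _.
have -> : `|t ^+ 2 / 2| = `|t| ^+ 2 / 2.
  by rewrite normrM normrX [X in _ * X]ger0_norm ?invr_ge0.
have -> : t ^+ 2 = `|t| ^+ 2 by rewrite real_normK ?num_real.
have : `|t| ^+ 3 <= `|t| ^+ 2 / 2.
  by rewrite (exprS _ 2); have := exprn_ge0 2 (normr_ge0 t); nra.
have := exprn_ge0 2 (normr_ge0 t).
by lra.
Qed.

Lemma ln1D_le (R : realType) (t : R) :
  `|t| <= 1 / 2 -> `|ln (1 + t)| <= 2 * `|t|.
Proof.
move=> t2; have := ln1D_taylor2 t2; set u := `|t| in t2 *.
have u0 : 0 <= u := normr_ge0 t.
move=> H; have -> : ln (1 + t) = (ln (1 + t) - t + t ^+ 2 / 2) + (t - t ^+ 2 / 2) by ring.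
apply: le_trans (ler_normD _ _) _.
have : `|t - t ^+ 2 / 2| <= u + u ^+ 2 / 2.
  apply: le_trans (ler_normB _ _) _.
  by rewrite [X in _ + X]normrM normrX [X in _ * X]ger0_norm ?invr_ge0.
have : u ^+ 3 <= u / 4 by rewrite !exprS expr0; nra.
have : u ^+ 2 <= u / 2 by rewrite !exprS expr0; nra.
by lra.
Qed.

(** * Wallis' product *)

(** The reduction formula for the powers of sine, read as the definition of an
    antiderivative; it lets the Wallis integrals be handled without integration. *)
Fixpoint sin_primitive (R : realType) (n : nat) : R -> R :=
  match n with
  | 0%N => id
  | 1%N => - (@cos R)
  | m.+2 => m.+2%:R^-1 *:
      (m.+1%:R *: @sin_primitive R m - (@cos R) * (@sin R) ^+ m.+1)
  end.

Lemma is_derive_sin_primitive (R : realType) n (x : R) :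
  is_derive x 1 (@sin_primitive R n) (sin x ^+ n).
Proof.
suff : is_derive x 1 (@sin_primitive R n) (sin x ^+ n) /\
  is_derive x 1 (@sin_primitive R n.+1) (sin x ^+ n.+1) by case.
elim: n => [|n [IHn IHn1]].
  split; first exact: (is_derive_id x (1 : R)).
  have D := is_deriveN (is_derive_cos x).
  by apply: (is_derive_eq D); rewrite opprK.
split; first exact: IHn1.
have D := is_deriveZ n.+2%:R^-1 (is_deriveB (is_deriveZ n.+1%:R IHn)
  (is_deriveM (is_derive_cos x) (is_deriveX n.+1 (is_derive_sin x)))).
apply: (is_derive_eq D); rewrite /GRing.scale /= /GRing.scale /=.
have cs : cos x ^+ 2 = 1 - sin x ^+ 2 by rewrite -(cos2Dsin2 x) addrK.
rewrite exprfctE.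
have -> : n.+1%:R * sin x ^+ n - (cos x * (n.+1%:R * sin x ^+ n * cos x) +
    sin x ^+ n.+1 * - sin x) = n.+2%:R * sin x ^+ n.+2.
  transitivity (n.+1%:R * sin x ^+ n * (1 - cos x ^+ 2) + sin x ^+ n.+2).
    by rewrite !exprS; ring.
  by rewrite cs !exprS -(natr1 n.+1); ring.
by rewrite mulrA mulVf ?mul1r ?pnatr_eq0.
Qed.

(** The integral of sin ^ n over [0, pi / 2]. *)
Definition wallis (R : realType) (n : nat) : R :=
  @sin_primitive R n (pi / 2) - @sin_primitive R n 0.

Lemma sin_primitiveSS (R : realType) n (x : R) :
  sin_primitive n.+2 x =
  n.+2%:R^-1 * (n.+1%:R * sin_primitive n x - cos x * sin x ^+ n.+1).
Proof. by rewrite /= exprfctE. Qed.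

Lemma wallisSS (R : realType) n :
  wallis R n.+2 = n.+1%:R / n.+2%:R * wallis R n.
Proof.
by rewrite /wallis !sin_primitiveSS cos_pihalf sin0 (exprS 0); ring.
Qed.

(** The powers of sine decrease with the exponent on [0, pi / 2]. *)
Lemma wallis_le (R : realType) n : wallis R n.+1 <= wallis R n.
Proof.
pose f : R -> R := @sin_primitive R n - @sin_primitive R n.+1.
have fd (x : R) : is_derive x 1 f (sin x ^+ n - sin x ^+ n.+1).
  exact: (is_deriveB (is_derive_sin_primitive n x) (is_derive_sin_primitive n.+1 x)).
have p2 : (0 : R) <= pi / 2 by have := pi_ge0 R; lra.
have fc : {within `[0, pi / 2], continuous f}.
  by apply: derivable_within_continuous => x _; have [] := fd x.
have [c] := MVT_segment p2 (fun x _ => fd x) fc.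
rewrite in_itv /= => /andP[c0 c2] fE; rewrite -subr_ge0.
have -> : wallis R n - wallis R n.+1 = f (pi / 2) - f 0.
  by rewrite /wallis /f; rewrite !fctE; ring.
rewrite fE subr0 mulr_ge0 // subr_ge0 exprS ler_piMl ?sin_le1 //.
by rewrite exprn_ge0 //; apply: sin_ge0_pi; have := pi_ge0 R; lra.
Qed.

(** The quotient of 4 ^ m by the central binomial coefficient. *)
Definition central (R : realType) (m : nat) : R :=
  4 ^+ m * (m`!%:R) ^+ 2 / (2 * m)`!%:R.

Lemma central_neq0 (R : realType) m : central R m != 0.
Proof.
by rewrite /central !mulf_neq0 ?invr_neq0 ?expf_neq0 // pnatr_eq0 // -lt0n fact_gt0.
Qed.

Lemma centralS (R : realType) m :
  central R m.+1 = (m.+1 * 2)%:R / (2 * m).+1%:R * central R m.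
Proof.
rewrite /central (_ : 2 * m.+1 = (2 * m).+2)%N; last by lia.
rewrite !factS !natrM exprS.
have f1 : (2 * m)`!%:R != 0 :> R by rewrite pnatr_eq0 -lt0n fact_gt0.
have e1 : (2 * m).+1%:R = 2 * m%:R + 1 :> R by rewrite -natr1 natrM.
have e2 : (2 * m).+2%:R = 2 * (m%:R + 1) :> R.
  by rewrite -!natr1 natrM; ring.
have f3 : m%:R + 1 != 0 :> R by rewrite natr1 pnatr_eq0.
have f4 : 2 * m%:R + 1 != 0 :> R by rewrite -e1 pnatr_eq0.
rewrite e1 e2 -(natr1 m); field.
by rewrite f1 f3 f4.
Qed.

Lemma wallis_even (R : realType) m : wallis R (2 * m) = pi / 2 / central R m.
Proof.
elim: m => [|m IHm].
  by rewrite /wallis /central /= expr0 !fact0 expr1n mulr1 divr1 subr0 divr1.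
rewrite (_ : 2 * m.+1 = (2 * m).+2)%N; last by lia.
rewrite wallisSS IHm centralS natrM.
have e1 : (2 * m).+1%:R = 2 * m%:R + 1 :> R by rewrite -natr1 natrM.
have e2 : (2 * m).+2%:R = 2 * (m%:R + 1) :> R.
  by rewrite -!natr1 natrM; ring.
have f3 : m%:R + 1 != 0 :> R by rewrite natr1 pnatr_eq0.
have f4 : 2 * m%:R + 1 != 0 :> R by rewrite -e1 pnatr_eq0.
have := central_neq0 R m => f5.
rewrite e1 e2 -(natr1 m); field.
by rewrite f5 f3 f4.
Qed.

Lemma wallis_odd (R : realType) m :
  wallis R (2 * m).+1 = central R m / (2 * m).+1%:R.
Proof.
elim: m => [|m IHm].
  rewrite /wallis /central /= !fctE cos_pihalf cos0 expr0 !fact0 expr1n.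
  by rewrite mulr1 !divr1; ring.
rewrite (_ : (2 * m.+1).+1 = (2 * m).+3)%N; last by lia.
rewrite wallisSS IHm centralS natrM.
have e1 : (2 * m).+1%:R = 2 * m%:R + 1 :> R by rewrite -natr1 natrM.
have e2 : (2 * m).+2%:R = 2 * (m%:R + 1) :> R.
  by rewrite -!natr1 natrM; ring.
have f4 : 2 * m%:R + 1 != 0 :> R by rewrite -e1 pnatr_eq0.
have e3 : (2 * m).+3%:R = 2 * m%:R + 3 :> R.
  by rewrite -!natr1 natrM; ring.
have f7 : 2 * m%:R + 3 != 0 :> R by rewrite -e3 pnatr_eq0.
rewrite e1 e2 e3 -(natr1 m); field.
by rewrite f4 f7.
Qed.

(** Both bounds come from the monotonicity of the Wallis integrals at the three
    consecutive indices 2 m - 1, 2 m and 2 m + 1. *)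
Lemma wallis_bounds (R : realType) m : (0 < m)%N ->
  pi * m%:R <= central R m ^+ 2 <= pi * (m%:R + 2^-1).
Proof.
move=> m0; have c0 : 0 < central R m.
  by rewrite /central !mulr_gt0 ?invr_gt0 ?exprn_gt0 // ltr0n fact_gt0.
have e1 : (2 * m).+1%:R = 2 * m%:R + 1 :> R by rewrite -natr1 natrM.
have mR : 0 < m%:R :> R by rewrite ltr0n.
have := wallis_le R (2 * m); have := wallis_le R (2 * m).-1.
rewrite prednK ?muln_gt0 // wallis_odd wallis_even e1.
have -> : wallis R (2 * m).-1 = central R m / (2 * m%:R).
  case: m m0 c0 e1 mR => // m _ c0 e1 mR.
  rewrite (_ : (2 * m.+1).-1 = (2 * m).+1)%N; last by lia.
  rewrite wallis_odd centralS natrM.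
  have e2 : (2 * m).+1%:R = 2 * m%:R + 1 :> R by rewrite -natr1 natrM.
  have f1 : 2 * m%:R + 1 != 0 :> R by rewrite -e2 pnatr_eq0.
  have f2 : m%:R + 1 != 0 :> R by rewrite natr1 pnatr_eq0.
  by rewrite e2 -natr1; field; rewrite addrC f2 f1.
rewrite ler_pdivrMr // mulrAC ler_pdivlMr ?mulr_gt0 // => H1.
rewrite ler_pdivlMr // mulrAC ler_pdivrMr ?addr_gt0 ?mulr_gt0 // => H2.
by apply/andP; split; lra.
Qed.

(** * Stirling's formula *)

(** Stirling's formula says that this tends to ln (2 pi) / 2. *)
Definition stirling_defect (R : realType) (k : nat) : R :=
  ln (k`!%:R) - (k%:R + 2^-1) * ln k%:R + k%:R.

(** With t = 1 / k the increment is 1 - (1 / t + 1 / 2) ln (1 + t), whose terms of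
    order 0 and 1 in t vanish; t ^ 2 is then compared with the telescoping
    difference 1 / k - 1 / (k + 1). *)
Lemma stirling_defect_step (R : realType) (k : nat) : (2 <= k)%N ->
  `|stirling_defect R k.+1 - stirling_defect R k| <= 6 * (k%:R^-1 - k.+1%:R^-1).
Proof.
move=> k2; have k0 : 2 <= k%:R :> R by rewrite (ler_nat _ 2).
have kn0 : k%:R != 0 :> R by rewrite gt_eqF //; lra.
set t : R := k%:R^-1.
have kt : k%:R * t = 1 by rewrite /t divff.
have t0 : 0 < t by rewrite invr_gt0; lra.
have t1 : t <= 1 / 2 by nra.
have lnE : ln k.+1%:R = ln k%:R + ln (1 + t) :> R.
  rewrite -lnM ?posrE; [congr ln|lra|lra].
  by rewrite mulrDr mulr1 kt natr1.
have -> : stirling_defect R k.+1 - stirling_defect R k =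
    1 - (k%:R + 2^-1) * ln (1 + t).
  rewrite /stirling_defect factS natrM lnM ?posrE ?ltr0n ?fact_gt0 // lnE.
  by rewrite -(natr1 k); ring.
have := @ln1D_taylor2 R t; rewrite (ger0_norm (ltW t0)) => /(_ t1).
set e := ln (1 + t) - t + t ^+ 2 / 2 => He.
have -> : 1 - (k%:R + 2^-1) * ln (1 + t) = t ^+ 2 / 4 - (k%:R + 2^-1) * e.
  have -> : ln (1 + t) = e + t - t ^+ 2 / 2 by rewrite /e; ring.
  transitivity (t ^+ 2 / 4 - (k%:R + 2^-1) * e + (1 - k%:R * t) * (1 - t / 2)).
    by field.
  by rewrite kt subrr mul0r addr0.
have -> : k%:R^-1 - k.+1%:R^-1 = t * k.+1%:R^-1 :> R.
  by rewrite /t -natr1; field; rewrite kn0 natr1 pnatr_eq0.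
have tk : t <= 2 * k.+1%:R^-1.
by rewrite ler_pdivlMr ?ltr0n // -(natr1 k) mulrDr mulr1 (mulrC t) kt; lra.
apply: (@le_trans _ _ (3 * t ^+ 2)).
  apply: le_trans (ler_normB _ _) _.
  rewrite [X in _ + X]normrM (ger0_norm (_ : 0 <= t ^+ 2 / 4)); last by nra.
  rewrite (ger0_norm (_ : 0 <= k%:R + 2^-1)); last by lra.
  have : (k%:R + 2^-1) * `|e| <= (k%:R + 2^-1) * (2 * t ^+ 3).
    by rewrite ler_wpM2l //; lra.
  have -> : (k%:R + 2^-1) * (2 * t ^+ 3) = 2 * (k%:R * t) * t ^+ 2 + t ^+ 3.
    by field.
  rewrite kt (exprS _ 2); have : 0 <= t ^+ 2 by rewrite exprn_ge0 // ltW.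
  by nra.
have := ler_wpM2l (ltW t0) tk; rewrite mulrCA -expr2.
set s := t / _.
by lra.
Qed.

Lemma cvg_invn (R : realType) : (k%:R^-1 : R) @[k --> \oo] --> (0 : R).
Proof.
apply/gtr0_cvgV0; last exact: cvgr_idn.
by near=> k; rewrite ltr0n; near: k; exists 1%N.
Unshelve. all: by end_near. Qed.

(** By the telescoping bound, from k = 2 on the defect minus 6 / k increases and
    the defect plus 6 / k decreases. *)
Lemma stirling_defect_cvg (R : realType) :
  exists c : R, stirling_defect R k @[k --> \oo] --> c.
Proof.
pose d := stirling_defect R.
pose u k : R := d (k + 2)%N - 6 * (k + 2)%:R^-1.
have cu : cvgn u.
  apply: nondecreasing_is_cvgn.
    apply/nondecreasing_seqP => k; rewrite /u addSn.
    have := @stirling_defect_step R (k + 2) (leq_addl _ _).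
    rewrite ler_norml -/d => /andP[+ _].
    by move: (k + 2)%:R^-1 (k + 2).+1%:R^-1 => x y; lra.
  exists (d 2 + 3) => _ [k _ <-]; rewrite /u.
  have H : d (k + 2)%N + 6 * (k + 2)%:R^-1 <= d 2 + 3.
    elim: k => [|k IHk]; first by rewrite add0n; lra.
    have := @stirling_defect_step R (k + 2) (leq_addl _ _).
    rewrite ler_norml addSn -/d => /andP[_]; move: IHk.
    by move: (k + 2)%:R^-1 (k + 2).+1%:R^-1 => x y; lra.
  have : 0 <= (k + 2)%:R^-1 :> R by rewrite invr_ge0.
  by move: H; move: (k + 2)%:R^-1 => x; lra.
exists (limn u); rewrite -(cvg_shiftn 2).
have -> : (fun k => stirling_defect R (k + 2)) = u \+ (fun k => 6 * (k + 2)%:R^-1).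
  by apply/funext => k /=; rewrite /u subrK.
rewrite -[limn u]addr0; apply: cvgD => //.
rewrite -(mulr0 6); apply: cvgMr.
have := @cvg_invn R; rewrite -(cvg_shiftn 2); exact.
Qed.

(** Links the limit c of the defect to Wallis' product: the right-hand side tends
    to 2 c - ln 2, the left-hand side to ln pi. *)
Lemma ln_central (R : realType) (m : nat) : (0 < m)%N ->
  ln (central R m ^+ 2 / m%:R) =
  4 * stirling_defect R m - 2 * stirling_defect R (2 * m) - ln 2.
Proof.
move=> m0; have mR : 0 < m%:R :> R by rewrite ltr0n.
have fR k : 0 < k`!%:R :> R by rewrite ltr0n fact_gt0.
rewrite ln_div ?posrE ?exprn_gt0 //; last by rewrite /central divr_gt0 ?mulr_gt0 ?exprn_gt0.
rewrite lnXn; last by rewrite /central divr_gt0 ?mulr_gt0 ?exprn_gt0.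
rewrite /central ln_div ?posrE ?mulr_gt0 ?exprn_gt0 //.
rewrite lnM ?posrE ?exprn_gt0 // !lnXn // /stirling_defect natrM lnM ?posrE //.
have -> : ln 4 = 2 * ln 2 :> R.
  by rewrite (_ : 4 = 2 ^+ 2 :> R) ?lnXn //; ring.
by field.
Qed.

Lemma stirling (R : realType) :
  stirling_defect R k @[k --> \oo] --> (ln (2 * pi) / 2 : R).
Proof.
have [c dc] := stirling_defect_cvg R.
suff -> : ln (2 * pi) / 2 = c by [].
have pi0 := pi_gt0 R.
rewrite lnM ?posrE //.
suff : ln pi = 4 * c - 2 * c - ln 2 by lra.
have d2c : stirling_defect R (2 * k) @[k --> \oo] --> c.
  apply: (@cvg_comp _ _ _ (fun k => 2 * k)%N) dc.
  by apply/cvgnyPge => A; near=> k; apply: leq_trans (leq_pmull k _) => //;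
    near: k; exists A.
have H1 : 4 * stirling_defect R k - 2 * stirling_defect R (2 * k) - ln 2
    @[k --> \oo] --> 4 * c - 2 * c - ln 2.
  apply: cvgB; last exact: cvg_cst.
  by apply: cvgB; apply: cvgMr.
apply: cvg_unique H1 => //.
have H2 : central R k ^+ 2 / k%:R @[k --> \oo] --> pi.
  apply: (@squeeze_cvgr _ _ _ _ (fun=> pi) (fun k => pi + pi / 2 * k%:R^-1)).
  - near=> k; have k0 : (0 < k)%N by near: k; exists 1%N.
    have kR : 0 < k%:R :> R by rewrite ltr0n.
    have := wallis_bounds R k0.
    have -> : pi * (k%:R + 2^-1) = (pi + pi / 2 * k%:R^-1) * k%:R :> R.
      by field; rewrite gt_eqF.
    by rewrite ler_pdivlMr // ler_pdivrMr.
  - exact: cvg_cst.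
  - rewrite -[X in _ --> X]addr0; apply: cvgD; first exact: cvg_cst.
    rewrite -(mulr0 (pi / 2)); apply: cvgMr; exact: (@cvg_invn R).
have H3 := continuous_cvg _ (continuous_ln pi0) H2.
rewrite /=; apply: cvg_trans (H3 _); apply: near_eq_cvg; near=> k.
by rewrite /= ln_central //; near: k; exists 1%N.
Unshelve. all: by end_near. Qed.

(** * Connected graphs divided by the factorial *)

Lemma powRE_gt0 (R : realType) (a x : R) : 0 < a -> a `^ x = expR (x * ln a).
Proof. by move=> a0; rewrite /powR gt_eqF. Qed.

(** The exponent k + 3 r / 2 - 2 in the definition of the Wright constant loses
    k + 1 / 2 to Stirling's formula, which leaves 3 r / 2 - 5 / 2. *)
Lemma connected_over_fact (R : realType) (w : nat -> R) (r : nat) (eta : R) :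
  wright_constants w -> 0 < eta ->
  \forall k \near \oo, exists2 y : R, `|y| <= eta &
    (num_connected k (k + r - 1))%:R / k`!%:R =
    w r / Num.sqrt (2 * pi) * k%:R `^ (3 * r%:R / 2 - 5 / 2) *
      expR k%:R * expR y.
Proof.
move=> /(_ r)[w0 /eqaddoP Hw] eta0.
pose delta : R := Num.min (1 / 2) (eta / 4).
have d0 : 0 < delta by rewrite lt_min; apply/andP; split; lra.
have d2 : delta <= 1 / 2 by rewrite ge_min lexx.
have d4 : delta <= eta / 4 by rewrite ge_min lexx orbT.
have eta2 : 0 < eta / 2 by lra.
have /cvgrPdist_le/(_ _ eta2) S := @stirling R.
have {Hw}cvg_w : \forall k \near \oo,
    `|(num_connected k (k + r - 1))%:R -
      w r * k%:R `^ (k%:R + 3 * r%:R / 2 - 2)| <=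
    delta * `|w r * k%:R `^ (k%:R + 3 * r%:R / 2 - 2)| := Hw _ d0.
near=> k.
have k0 : (0 < k)%N by near: k; exists 1%N.
have kR : 0 < k%:R :> R by rewrite ltr0n.
set c : R := (num_connected _ _)%:R.
pose g : R := w r * k%:R `^ (k%:R + 3 * r%:R / 2 - 2).
have g0 : 0 < g by rewrite mulr_gt0 ?powR_gt0.
have cg : `|c - g| <= delta * `|g|.
  by rewrite /c /g; near: k; exact: cvg_w.
pose t := (c - g) / g.
have ct : c = g * (1 + t).
  by rewrite /t mulrDr mulr1 mulrCA divff ?gt_eqF // mulr1 addrC subrK.
have t1 : `|t| <= delta.
  by rewrite /t normrM normfV ler_pdivrMr ?normr_gt0 ?gt_eqF.
have t2 := le_trans t1 d2.
have tgt : 0 < 1 + t by move: t2; rewrite ler_norml => /andP[]; lra.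
exists (ln (1 + t) + (ln (2 * pi) / 2 - stirling_defect R k)).
  apply: le_trans (ler_normD _ _) _.
  have := ln1D_le t2.
  have : `|ln (2 * pi) / 2 - stirling_defect R k| <= eta / 2.
    by near: k; exact: S.
  by lra.
have pi2 : 0 < 2 * pi :> R by rewrite mulr_gt0 // pi_gt0.
have fR : 0 < k`!%:R :> R by rewrite ltr0n fact_gt0.
have -> : k`!%:R = expR (ln (k`!%:R)) :> R by rewrite lnK.
have -> : Num.sqrt (2 * pi) = expR (ln (2 * pi) / 2) :> R.
  by rewrite -powR12_sqrt ?(ltW pi2) // powRE_gt0 // mulrC.
rewrite ct /g !powRE_gt0 // [expR (ln (1 + t) + _)]expRD [expR (ln (1 + t))]lnK ?posrE //.
set E1 := expR (_ * ln k%:R); set E2 := expR (ln k`!%:R).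
set E3 := expR (_ / 2); set E4 := expR (_ * ln k%:R).
set E5 := expR k%:R; set E6 := expR _.
have E16 : E1 / E2 = E4 * E5 * E6 / E3.
  rewrite /E1 /E2 /E3 /E4 /E5 /E6 -!expRN -!expRD; congr expR.
  by rewrite /stirling_defect; field.
transitivity (w r * (1 + t) * (E1 / E2)); first by ring.
by rewrite E16; ring.
Unshelve. all: by end_near. Qed.

(** * Expansion of the weight on the logarithmic scale *)

(** Summing the second-order expansion of ln (1 - j / n) over j < K; the two
    explicit terms are the sums of j / n and of j ^ 2 / (2 n ^ 2). *)
Lemma ln_ffact (R : realType) (n K : nat) : (2 * K <= n)%N ->
  `|ln (n ^_ K)%:R - K%:R * ln n%:R + K%:R * (K%:R - 1) / (2 * n%:R)
    + (K%:R - 1) * K%:R * (2 * K%:R - 1) / (12 * n%:R ^+ 2)|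
  <= 2 * K%:R ^+ 4 / n%:R ^+ 3 :> R.
Proof.
elim: K => [|K IHK] Kn.
  by rewrite ffactn0 ln1 !mul0r !(mulr0, mul0r) !(subr0, addr0) normr0 expr0n /= mulr0 mul0r.
have n0 : 0 < n%:R :> R by rewrite ltr0n; lia.
have {}IHK : _ := IHK ltac:(lia).
set k : R := K%:R in IHK *; set N : R := n%:R in n0 IHK *.
have k0 : 0 <= k by rewrite ler0n.
have kN : 2 * k <= N by rewrite -natrM ler_nat; lia.
pose t := k / N.
have t0 : 0 <= t by rewrite divr_ge0 // ltW.
have t2 : `|- t| <= 1 / 2 by rewrite normrN ger0_norm // ler_pdivrMr //; lra.
have := ln1D_taylor2 t2; rewrite normrN (ger0_norm t0) => H.
have lnE : ln (n ^_ K.+1)%:R = ln (n ^_ K)%:R + ln N + ln (1 - t) :> R.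
  rewrite ffactnSr natrM lnM ?posrE ?ltr0n ?subn_gt0 ?ffact_gt0; [|lia|lia].
  rewrite -addrA; congr (_ + _); rewrite -lnM ?posrE //; last first.
    by move: t2; rewrite normrN ger0_norm //; lra.
  by rewrite natrB; [rewrite /t; congr ln; field; rewrite gt_eqF|lia].
rewrite lnE -(natr1 K) -/k.
set A := ln _ - _ + _ + _ in IHK; set B := ln (1 - t) - _ + _ in H.
have -> : ln (n ^_ K)%:R + ln N + ln (1 - t) - (k + 1) * ln N +
   (k + 1) * (k + 1 - 1) / (2 * N) +
   (k + 1 - 1) * (k + 1) * (2 * (k + 1) - 1) / (12 * N ^+ 2) = A + B.
  by rewrite /A /B /t; field; rewrite gt_eqF.
apply: le_trans (ler_normD _ _) _; apply: le_trans (lerD IHK H) _.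
rewrite [X in _ + X](_ : _ = 2 * k ^+ 3 / N ^+ 3); last first.
  by rewrite /t expr_div_n mulrA.
rewrite -mulrDl ler_pM2r ?invr_gt0 ?exprn_gt0 //.
have := exprn_ge0 3 k0; have := exprn_ge0 2 k0.
have -> : (k + 1) ^+ 4 = k ^+ 4 + 4 * k ^+ 3 + 6 * k ^+ 2 + 4 * k + 1 by ring.
by lra.
Qed.

Lemma ler_normM_bound (R : realType) (a b A B : R) :
  `|a| <= A -> `|b| <= B -> `|a * b| <= A * B.
Proof. by move=> aA bB; rewrite normrM ler_pM. Qed.

Lemma ler_normD_bound (R : realType) (a b A B : R) :
  `|a| <= A -> `|b| <= B -> `|a + b| <= A + B.
Proof. by move=> aA bB; apply: le_trans (ler_normD _ _) (lerD aA bB). Qed.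

(** Once the divergent terms have cancelled against each other and the terms of
    order 0 against F, h times this polynomial is left; x stands for K * h ^ 2
    and s for M - K. *)
Lemma remainder_bound (R : realType) (Lam X S h lambda x s : R) :
  0 <= h <= 1 -> 0 <= x <= X -> `|lambda| <= Lam -> `|s| <= S ->
  `|x / 2 + x ^+ 2 * h / 4 - x * h ^+ 3 / 12 + s * lambda
    - s * lambda ^+ 2 * h / 2 + (1 + lambda * h) * (3 * x / 2 + s * h ^+ 2)|
  <= X + X ^+ 2 + S * Lam + S * Lam ^+ 2 + (1 + Lam) * (2 * X + S).
Proof.
move=> /andP[h0 h1] /andP[x0 xX] lL sS.
have S0 := le_trans (normr_ge0 _) sS; have L0 := le_trans (normr_ge0 _) lL.
have hk k : 0 <= h ^+ k <= 1 by rewrite exprn_ge0 //= exprn_ile1.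
have hn k : `|h ^+ k| <= 1 by rewrite ger0_norm; have /andP[] := hk k.
have hn1 : `|h| <= 1 by rewrite -[h]expr1.
have xx : x ^+ 2 <= X ^+ 2 by rewrite ler_sqr ?nnegrE //; lra.
have x20 : 0 <= x ^+ 2 by rewrite exprn_ge0.
have B1 : `|x / 2 + x ^+ 2 * h / 4 - x * h ^+ 3 / 12| <= X + X ^+ 2.
  have /andP[h30 h31] := hk 3%N.
  have H1 : 0 <= x ^+ 2 * h <= x ^+ 2 by rewrite mulr_ge0 //= ler_piMr.
  have H2 : 0 <= x * h ^+ 3 <= x by rewrite mulr_ge0 //= ler_piMr.
  by rewrite ler_norml; apply/andP; split; lra.
have B2 : `|s * lambda| <= S * Lam by exact: ler_normM_bound.
have B3 : `|s * lambda ^+ 2 * h / 2| <= S * Lam ^+ 2.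
  have -> : s * lambda ^+ 2 * h / 2 = s * (lambda * lambda) * (h / 2) by ring.
  rewrite -[S * _]mulr1; apply: ler_normM_bound; last first.
    by rewrite normrM [X in _ * X]ger0_norm ?invr_ge0 //; lra.
  by rewrite expr2; do 2! apply: ler_normM_bound => //.
have B4 : `|(1 + lambda * h) * (3 * x / 2 + s * h ^+ 2)| <= (1 + Lam) * (2 * X + S).
  apply: ler_normM_bound; apply: ler_normD_bound.
  - by rewrite normr1.
  - by rewrite -[Lam]mulr1; apply: ler_normM_bound.
  - by rewrite ger0_norm; lra.
  - by rewrite -[S]mulr1; apply: ler_normM_bound.
apply: ler_normD_bound B4; apply: ler_normD_bound; last by rewrite normrN.
exact: ler_normD_bound B2.
Qed.

(** The hypothesis on D expresses the number of absent pairs.  The error collects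
    the three Taylor remainders, weighted by 1, M and D, of sizes K ^ 4 / n ^ 3,
    M * h ^ 3 and D * h ^ 6, all O(h), and h times the polynomial of
    [remainder_bound]. *)
Lemma log_weight_bound (R : realType) (Lam X S h lambda : R) (n K M D : nat) :
  0 < h -> n%:R * h ^+ 3 = 1 -> h <= 1 -> X * h <= 1 / 2 ->
  (1 + Lam) * h <= 1 / 2 -> `|lambda| <= Lam -> K%:R * h ^+ 2 <= X ->
  `|M%:R - K%:R| <= S ->
  D%:R = K%:R * (2 * n%:R - K%:R - 1) / 2 - M%:R :> R ->
  exists2 err : R,
    `|err| <= (2 * X ^+ 4 + 2 * Lam ^+ 3 * (X + S) + 2 * (1 + Lam) ^+ 2 * X +
      (X + X ^+ 2 + S * Lam + S * Lam ^+ 2 + (1 + Lam) * (2 * X + S))) * h &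
    (n ^_ K)%:R * ((h ^+ 3 * (1 + lambda * h)) ^+ M *
      (1 - h ^+ 3 * (1 + lambda * h)) ^+ D) =
    expR ((K%:R - M%:R) * ln n%:R - K%:R - F (K%:R * h ^+ 2) lambda + err).
Proof.
move=> h0 nh h1 Xh Lh lL KX MK DE.
have K0 : 0 <= K%:R :> R by [].
have M0 : 0 <= M%:R :> R by [].
have D0 : 0 <= D%:R :> R by [].
have S0 := le_trans (normr_ge0 _) MK; have L0 := le_trans (normr_ge0 _) lL.
have hk k : 0 <= h ^+ k <= 1 by rewrite exprn_ge0 ?exprn_ile1 //= ltW.
have hgt k : 0 < h ^+ k by rewrite exprn_gt0.
have nE : n%:R = (h ^+ 3)^-1 :> R.
  by apply: (mulIf (lt0r_neq0 (hgt 3%N))); rewrite nh mulVf ?gt_eqF.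
have n0 : 0 < n%:R :> R by rewrite nE invr_gt0.
set x := K%:R * h ^+ 2 in KX *.
have x0 : 0 <= x by rewrite mulr_ge0 // ltW.
have X0 : 0 <= X by lra.
have KN : (2 * K <= n)%N.
  rewrite -(ler_nat R) natrM -(ler_pM2r (hgt 3%N)) nh.
  have -> : 2 * K%:R * h ^+ 3 = 2 * (x * h) by rewrite /x; ring.
  by have := ler_wpM2r (ltW h0) KX; lra.
have lh : `|lambda * h| <= Lam * h.
  by apply: ler_normM_bound; rewrite // ger0_norm // ltW.
have lh2 : `|lambda * h| <= 1 / 2 by lra.
set p := h ^+ 3 * (1 + lambda * h).
have onelh : `|1 + lambda * h| <= 1 + Lam.
  apply: ler_normD_bound; first by rewrite normr1.
  by rewrite -[Lam]mulr1; apply: ler_normM_bound; rewrite // ger0_norm // ltW.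
have onelh0 : 0 < 1 + lambda * h.
  by move: lh2; rewrite ler_norml => /andP[]; lra.
have p0 : 0 < p by rewrite mulr_gt0.
have p2 : `|- p| <= 1 / 2.
  rewrite normrN; apply: le_trans (_ : h * (1 + Lam) <= _); last by lra.
  apply: ler_normM_bound onelh; rewrite ger0_norm ?(ltW (hgt _)) //.
  by rewrite exprS -[X in _ <= X]mulr1 ler_pM2l //; have /andP[] := hk 2%N.
have p1 : 0 < 1 - p by move: p2; rewrite ler_norml => /andP[]; lra.
have T1 := @ln_ffact R n K KN.
have T2 := ln1D_taylor2 lh2.
have T3 := ln1D_taylor1 p2.
set e1 := (X in `|X| <= _) in T1.
set e2 := (X in `|X| <= _) in T2.
set e3 := (X in `|X| <= _) in T3.
set s := M%:R - K%:R in MK.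
pose G := x / 2 + x ^+ 2 * h / 4 - x * h ^+ 3 / 12 + s * lambda
    - s * lambda ^+ 2 * h / 2 + (1 + lambda * h) * (3 * x / 2 + s * h ^+ 2).
(* With this error the identity between the exponents is exact: G * h is made of
   the terms of order h that do not come from a Taylor remainder. *)
exists (e1 + M%:R * e2 + D%:R * e3 + G * h).
  set G0 := X + X ^+ 2 + _ + _ + _.
  have -> : (2 * X ^+ 4 + 2 * Lam ^+ 3 * (X + S) + 2 * (1 + Lam) ^+ 2 * X + G0) * h
    = 2 * (X ^+ 4 * h) + 2 * (Lam ^+ 3 * h ^+ 1 * (X + S)) +
      2 * ((1 + Lam) ^+ 2 * h ^+ 1 * X) + G0 * h by ring.
  apply: ler_normD_bound; last first.
    apply: ler_normM_bound; last by rewrite ger0_norm // ltW.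
    by apply: remainder_bound; rewrite // ?x0 // h1 ltW.
  apply: ler_normD_bound; [apply: ler_normD_bound|].
  - apply: le_trans T1 _; rewrite nE.
    have -> : 2 * K%:R ^+ 4 / (h ^+ 3)^-1 ^+ 3 = 2 * (x ^+ 4 * h) :> R.
      by rewrite /x; field; rewrite gt_eqF.
    by rewrite ler_pM2l // ler_pM2r // lerXn2r // nnegrE.
  - rewrite normrM ger0_norm //.
    apply: le_trans (ler_wpM2l M0 T2) _.
    have -> : M%:R * (2 * `|lambda * h| ^+ 3) =
        2 * (`|lambda| ^+ 3 * h ^+ 1 * (M%:R * h ^+ 2)).
      by rewrite normrM (ger0_norm (ltW h0)); ring.
    rewrite ler_pM2l //; apply: ler_pM => //.
    + by rewrite mulr_ge0 ?exprn_ge0 // ltW.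
    + by rewrite mulr_ge0 // ltW.
    + by rewrite ler_pM2r // lerXn2r // nnegrE.
    have -> : M%:R * h ^+ 2 = x + s * h ^+ 2 by rewrite /x /s; ring.
    apply: lerD => //; apply: le_trans (ler_norm _) _.
    rewrite -[S]mulr1; apply: ler_normM_bound => //.
    by rewrite ger0_norm; have /andP[] := hk 2%N.
  - rewrite normrM ger0_norm //.
    apply: le_trans (ler_wpM2l D0 T3) _.
    have -> : D%:R * (2 * (- p) ^+ 2) =
        2 * ((1 + lambda * h) ^+ 2 * h ^+ 1 * (D%:R * h ^+ 5)).
      by rewrite /p; ring.
    rewrite ler_pM2l //; apply: ler_pM => //.
    + by rewrite mulr_ge0 ?sqr_ge0 // ltW.
    + by rewrite mulr_ge0 // ltW.
    + rewrite ler_pM2r // lerXn2r ?nnegrE ?(ltW onelh0) //; first by lra.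
      exact: le_trans (ler_norm _) onelh.
    apply: le_trans KX; have -> : x = K%:R * n%:R * h ^+ 5.
      by rewrite /x nE; field; rewrite gt_eqF.
    rewrite ler_pM2r // DE.
    have : 0 <= K%:R * (K%:R + 1) :> R by rewrite mulr_ge0 // addr_ge0.
    have -> : K%:R * (2 * n%:R - K%:R - 1) / 2 =
        K%:R * n%:R - K%:R * (K%:R + 1) / 2 :> R by field.
    by lra.
have -> : (n ^_ K)%:R = expR (ln (n ^_ K)%:R) :> R.
  have Kn : (K <= n)%N by apply: leq_trans KN; rewrite leq_pmull.
  have ff0 : (n ^_ K)%:R \in @Num.pos R by rewrite posrE ltr0n ffact_gt0.
  by rewrite (lnK ff0).
have -> : p ^+ M = expR (M%:R * ln p) by rewrite expRM_natl lnK.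
have -> : (1 - p) ^+ D = expR (D%:R * ln (1 - p)) by rewrite expRM_natl lnK.
rewrite -!expRD; congr expR.
have -> : ln p = ln (1 + lambda * h) - ln n%:R.
  by rewrite /p lnM ?posrE // nE lnV ?posrE // opprK addrC.
have -> : ln (n ^_ K)%:R = e1 + K%:R * ln n%:R - K%:R * (K%:R - 1) / (2 * n%:R)
    - (K%:R - 1) * K%:R * (2 * K%:R - 1) / (12 * n%:R ^+ 2) by rewrite /e1; ring.
have -> : K%:R * (K%:R - 1) / (2 * n%:R) = K%:R * (K%:R - 1) * h ^+ 3 / 2 :> R.
  by rewrite nE; field; rewrite gt_eqF.
have -> : (K%:R - 1) * K%:R * (2 * K%:R - 1) / (12 * n%:R ^+ 2) =
    (K%:R - 1) * K%:R * (2 * K%:R - 1) * h ^+ 6 / 12 :> R.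
  by rewrite nE; field; rewrite gt_eqF.
have -> : ln (1 + lambda * h) = e2 + lambda * h - (lambda * h) ^+ 2 / 2.
  by rewrite /e2; ring.
have -> : D%:R * ln (1 - p) = D%:R * e3 - (1 + lambda * h) *
    (K%:R - K%:R * (K%:R + 1) / 2 * h ^+ 3 - M%:R * h ^+ 3).
  have -> : ln (1 - p) = e3 - p by rewrite /e3; ring.
  rewrite mulrBr; congr (_ - _); rewrite DE /p.
  by rewrite nE; field; rewrite gt_eqF.
move: (ln n%:R) e1 T1 e2 T2 e3 T3 => lnn e1 _ e2 _ e3 _.
by rewrite /G /s /F /x; field.
Qed.

(** * Assembling the uniform estimate *)

Lemma bin2_diff (n K : nat) : (K <= n)%N ->
  (2 * ('C(n, 2) - 'C(n - K, 2)) = K * (2 * n - K - 1))%N.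
Proof.
move=> Kn; have dbl m : (2 * 'C(m, 2) = m * m.-1)%N.
  by rewrite -(mul_bin_diag m 1) bin1.
rewrite mulnBr !dbl; have [m ->] : exists m, n = (K + m)%N.
  by exists (n - K)%N; lia.
have -> : (K + m - K = m)%N by lia.
case: m => [|m]; first by case: K Kn => // K _; nia.
nia.
Qed.

Lemma sum_tree_edges (q : nat) (k r : 'I_q -> nat) : (forall i, 0 < k i)%N ->
  (\sum_i (k i + r i - 1) + q = \sum_i k i + \sum_i r i)%N.
Proof.
move=> k0; have qE : q = (\sum_(i < q) 1)%N by rewrite sum1_card card_ord.
rewrite -big_split /= [X in (_ + X)%N]qE -big_split /=.
by apply: eq_bigr => i _; have := k0 i; lia.
Qed.

(** Ensures that the truncated subtraction in the exponent of 1 - p is exact. *)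
Lemma edges_le_pairs (n K M q rs : nat) :
  (M + q = K + rs -> 0 < K -> 2 * K <= n -> 2 * rs + 3 <= n ->
   M <= 'C(n, 2) - 'C(n - K, 2))%N.
Proof.
move=> MK K0 Kn rn; rewrite -(leq_pmul2l (isT : 0 < 2)%N) bin2_diff; last by lia.
nia.
Qed.

Lemma free_pairs_natr (R : realType) (n K M : nat) : (0 < n)%N -> (2 * K <= n)%N ->
  (M <= 'C(n, 2) - 'C(n - K, 2))%N ->
  ('C(n, 2) - 'C(n - K, 2) - M)%:R =
  K%:R * (2 * n%:R - K%:R - 1) / 2 - M%:R :> R.
Proof.
move=> n0 KNn MQ; rewrite natrB //; congr (_ - _).
have Kn : (K <= n)%N by lia.
have /(congr1 (fun j => j%:R : R)) := bin2_diff Kn.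
have -> : (K * (2 * n - K - 1))%:R = K%:R * (2 * n%:R - K%:R - 1) :> R.
  by rewrite natrM natrB; [rewrite natrB; [rewrite natrM|lia]|lia].
by rewrite natrM; lra.
Qed.

Definition inv_cbrt (R : realType) (n : nat) : R := n%:R `^ (- (1 / 3)).

Section InvCbrt.
Variables (R : realType) (n : nat).
Hypothesis n0 : (0 < n)%N.
Let h : R := inv_cbrt R n.

Let nR : 0 < n%:R :> R. Proof. by rewrite ltr0n. Qed.

Lemma inv_cbrt_gt0 : 0 < h. Proof. by rewrite powR_gt0. Qed.

Let hE : h = expR (- (1 / 3) * ln n%:R). Proof. by rewrite -powRE_gt0. Qed.

Lemma mul_inv_cbrt3 : n%:R * h ^+ 3 = 1.
Proof.
rewrite -[n%:R]lnK ?posrE // hE -expRM_natl -expRD; apply: etrans (@expR0 R).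
by congr expR; field.
Qed.

Lemma rescaledE j : rescaled R n j = j%:R * h ^+ 2.
Proof.
rewrite /rescaled; congr (_ * _).
by rewrite powRE_gt0 // hE -expRM_natl; congr expR; field.
Qed.

Lemma p_critE lambda : p_crit n lambda = h ^+ 3 * (1 + lambda * h).
Proof.
rewrite /p_crit mulrDr mulr1 mulrCA -exprSr; congr (_ + _ * _).
  by apply: (mulfI (lt0r_neq0 nR)); rewrite mul_inv_cbrt3 divff ?gt_eqF.
by rewrite powRE_gt0 // hE -expRM_natl; congr expR; field.
Qed.

End InvCbrt.

Lemma near_inv_cbrt_le (R : realType) (e : R) : 0 < e ->
  \forall n \near \oo, inv_cbrt R n <= e.
Proof.
move=> e0; near=> n.
have n0 : 0 < n%:R :> R by rewrite ltr0n; near: n; exists 1%N.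
rewrite /inv_cbrt powRE_gt0 // -(@lnK _ e) ?posrE // ler_expR.
suff : - 3 * ln e <= ln n%:R by lra.
have -> : - 3 * ln e = ln (e ^- 3) by rewrite lnV ?posrE ?exprn_gt0 // lnXn //; ring.
rewrite ler_ln ?posrE ?invr_gt0 ?exprn_gt0 //.
by near: n; exact: nbhs_infty_ger.
Unshelve. all: by end_near. Qed.

(** Collects the powers of n: evaluating the i-th density at k_i instead of
    k_i * n ^ (- 2 / 3) costs a factor n ^ (r_i - 5 / 3), while M - K is the total
    surplus minus q. *)
Lemma L_eq_of_logs (R : realType) (w : nat -> R) (n q : nat) (lambda err : R)
    (k r : 'I_q -> nat) (y : 'I_q -> R) :
  let h := inv_cbrt R n in
  let K := (\sum_i k i)%N in let M := (\sum_i (k i + r i - 1))%N in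
  (0 < n)%N -> (forall i, 0 < k i)%N ->
  (forall i, (num_connected (k i) (k i + r i - 1))%:R / (k i)`!%:R =
    w (r i) / Num.sqrt (2 * pi) * (k i)%:R `^ (3 * (r i)%:R / 2 - 5 / 2) *
      expR (k i)%:R * expR (y i)) ->
  (n ^_ K)%:R * (p_crit n lambda ^+ M *
      (1 - p_crit n lambda) ^+ ('C(n, 2) - 'C(n - K, 2) - M)) =
    expR ((K%:R - M%:R) * ln n%:R - K%:R - F (K%:R * h ^+ 2) lambda + err) ->
  L n lambda k r = L_limit w n lambda k r * expR (err + \sum_i y i).
Proof.
move=> h K M n0 k0 yE errE.
rewrite L_exact // -/K -/M; have nR : 0 < n%:R :> R by rewrite ltr0n.
have cnt := count_disjoint_family 'I_n k; rewrite card_ord -/K in cnt.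
have -> : (#|[set C : {ffun 'I_q -> {set 'I_n}} |
      disjoint_family C && [forall i, #|C i| == k i]]%SET|)%:R *
      \prod_i (num_connected (k i) (k i + r i - 1))%:R =
    (n ^_ K)%:R * \prod_i ((num_connected (k i) (k i + r i - 1))%:R / (k i)`!%:R) :> R.
  rewrite -cnt natrM big_split /= prodfV natr_prod.
  rewrite -!mulrA; congr (_ * _).
  rewrite [RHS]mulrCA divff ?mulr1 //.
  by apply/prodf_neq0 => i _; rewrite pnatr_eq0 -lt0n fact_gt0.
rewrite mulrAC errE.
rewrite (eq_bigr (fun i => rho w (r i) (rescaled R n (k i)) *
    expR ((k i)%:R + y i + (2 / 3) * (3 * (r i)%:R / 2 - 5 / 2) * ln n%:R))); last first.
  move=> i _; rewrite yE /rho -!mulrA; congr (_ * (_ * _)).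
  rewrite /rescaled powRM // -powRrM !powRE_gt0 ?ltr0n // -!expRD.
  by congr expR; ring.
rewrite big_split /= -expR_sum /L_limit /m_density powRE_gt0 //.
have -> : \sum_(i < q) rescaled R n (k i) = K%:R * h ^+ 2.
  by rewrite /K natr_sum mulr_suml; apply: eq_bigr => i _; rewrite rescaledE.
set P := \prod_(i < q) rho _ _ _; set E1 := expR (_ + err).
set E2 := expR (\sum_(i < q) _); set E3 := expR (- _ * ln _).
set E4 := expR (- F _ _); set E5 := expR (err + _).
suff E12 : E1 * E2 = E3 * E4 * E5.
  by transitivity (P * (E1 * E2)); [ring|rewrite E12; ring].
rewrite -!expRD; congr expR.
have -> : M%:R = K%:R + (\sum_i r i)%:R - q%:R :> R.
  by rewrite -natrD -(sum_tree_edges r k0) natrD addrK.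
rewrite !big_split /= -natr_sum -/K -mulr_suml -mulr_sumr sumrB.
rewrite -!mulr_suml -mulr_sumr -natr_sum sumr_const card_ord -mulr_natl.
by field.
Qed.

(** Half of eta is allotted to the error of the weight, which is at most C * h, and
    eta / (2 q) to each connected-graph factor, for which k_i must exceed a
    threshold N; this holds because k_i * h >= k_i * h ^ 2 >= a. *)
Lemma L_eq_limit_expR (R : realType) (w : nat -> R) (q : nat) (r : 'I_q -> nat)
    (a b Lam eta : R) :
  wright_constants w -> (0 < q)%N -> 0 < a -> a < b -> 0 <= Lam -> 0 < eta ->
  \forall n \near \oo, forall (lambda : R) (k : 'I_q -> nat),
    `|lambda| <= Lam -> (forall i, a <= rescaled R n (k i) <= b) ->
    exists2 y : R, `|y| <= eta &
      L n lambda k r = L_limit w n lambda k r * expR y.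
Proof.
move=> hw q0 a0 ab L0 eta0.
have qR : 0 < q%:R :> R by rewrite ltr0n.
have eta2q : 0 < eta / (2 * q%:R) by rewrite divr_gt0 // mulr_gt0.
have [N _ HN] := filter_forall _ (fun i => connected_over_fact (r i) hw eta2q).
pose X : R := q%:R * b.
have X0 : 0 < X by rewrite mulr_gt0 //; lra.
pose S : R := (\sum_i r i)%:R + q%:R.
have S0 : 0 <= S by rewrite addr_ge0.
pose C : R := 2 * X ^+ 4 + 2 * Lam ^+ 3 * (X + S) + 2 * (1 + Lam) ^+ 2 * X +
      (X + X ^+ 2 + S * Lam + S * Lam ^+ 2 + (1 + Lam) * (2 * X + S)).
have C0 : 0 <= C.
  have Xw := ltW X0.
  by rewrite /C; do ?[by [] | apply: addr_ge0 | apply: mulr_ge0 | apply: exprn_ge0].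
near=> n => lambda k lL kab.
have n0 : (0 < n)%N by near: n; exists 1%N.
pose h : R := inv_cbrt R n.
have h0 : 0 < h := inv_cbrt_gt0 R n0.
have h1 : h <= 1 by rewrite /h; near: n; apply: near_inv_cbrt_le.
have hX : X * h <= 1 / 2.
  rewrite mulrC -ler_pdivlMr // /h; near: n; apply: near_inv_cbrt_le.
  by rewrite !divr_gt0.
have hL : (1 + Lam) * h <= 1 / 2.
  have L1 : 0 < 1 + Lam by lra.
  rewrite mulrC -ler_pdivlMr // /h; near: n; apply: near_inv_cbrt_le.
  by rewrite !divr_gt0 //; lra.
have hC : C * h <= eta / 2.
  have C1 : 0 < C + 1 by lra.
  have : h * (C + 1) <= eta / 2.
    rewrite -ler_pdivlMr // /h; near: n; apply: near_inv_cbrt_le.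
    by rewrite !divr_gt0 //; lra.
  by lra.
have hN : N%:R * h <= a.
  have N1 : 0 < N.+1%:R :> R by rewrite ltr0n.
  have : h * N.+1%:R <= a.
    rewrite -ler_pdivlMr // /h; near: n; apply: near_inv_cbrt_le.
    by rewrite !divr_gt0.
  by rewrite -(natr1 N); lra.
have nbig : (2 * (\sum_i r i) + 3 <= n)%N.
  by near: n; exists (2 * (\sum_i r i) + 3)%N.
have nh3 : n%:R * h ^+ 3 = 1 := mul_inv_cbrt3 R n0.
have resc j : rescaled R n j = j%:R * h ^+ 2 := rescaledE R n0 j.
have kN i : (N <= k i)%N.
  rewrite -(ler_nat R) -(ler_pM2r h0); apply: le_trans hN _.
  have /andP[+ _] := kab i; rewrite resc => /le_trans; apply.
  by rewrite ler_wpM2l // expr2 ler_piMr // ltW.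
have k0 i : (0 < k i)%N.
  rewrite -(ltr_nat R) -(ltr_pM2r (exprn_gt0 2 h0)) mul0r.
  by have /andP[+ _] := kab i; rewrite resc; apply: lt_le_trans.
have /fin_all_exists2[y yle yE] i := HN _ (kN i) i.
pose K := (\sum_i k i)%N; pose M := (\sum_i (k i + r i - 1))%N.
pose D := ('C(n, 2) - 'C(n - K, 2) - M)%N.
have KX : K%:R * h ^+ 2 <= X.
  rewrite /K natr_sum mulr_suml /X mulr_natl -[q in _ *+ q]card_ord -sumr_const.
  by apply: ler_sum => i _; rewrite -resc; have /andP[] := kab i.
have KNn : (2 * K <= n)%N.
  rewrite -(ler_nat R) natrM -(ler_pM2r (exprn_gt0 3 h0)) nh3.
  have -> : 2 * K%:R * h ^+ 3 = 2 * (K%:R * h ^+ 2 * h) by ring.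
  by have := ler_wpM2r (ltW h0) KX; lra.
have MK : (M + q = K + \sum_i r i)%N := sum_tree_edges r k0.
have K0 : (0 < K)%N by rewrite /K (bigD1 (Ordinal q0)) //= ltn_addr.
have MQ := edges_le_pairs MK K0 KNn nbig.
have DE := free_pairs_natr R n0 KNn MQ.
have MS : `|M%:R - K%:R| <= S :> R.
  have -> : M%:R - K%:R = (\sum_i r i)%:R - q%:R :> R.
    by apply/eqP; rewrite subr_eq addrAC eq_sym subr_eq -!natrD MK addnC.
  by apply: le_trans (ler_normB _ _) _; rewrite !ger0_norm.
have [err errC errE] := log_weight_bound h0 nh3 h1 hX hL lL KX MS DE.
exists (err + \sum_i y i); last first.
  by apply: L_eq_of_logs => //; rewrite p_critE.
apply: le_trans (ler_normD _ _) _; rewrite [eta]splitr.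
apply: lerD; first exact: le_trans errC hC.
apply: le_trans (ler_norm_sum _ _ _) _.
apply: le_trans (ler_sum _ (fun i _ => yle i)) _.
rewrite sumr_const card_ord -mulr_natl le_eqVlt; apply/orP; left; apply/eqP.
by field; rewrite gt_eqF.
Unshelve. all: by end_near. Qed.

Lemma expR_sub1_le (R : realType) (y : R) :
  `|y| <= 1 / 2 -> `|expR y - 1| <= 2 * `|y|.
Proof.
move=> y2; have H1 := expR_ge1Dx y.
have H2 : (1 - y) * expR y <= 1.
  by rewrite -ler_pdivlMr ?expR_gt0 // div1r -expRN expR_ge1Dx.
have z0 := expR_gt0 y; set z := expR y in H1 H2 z0 *.
have := ler_norm y; have := ler_norm (- y); rewrite normrN => yl yr.
rewrite ler_norml; apply/andP; split; first by lra.
by have [y0|y0] := lerP 0 y; nra.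
Qed.

Lemma L_limit_ge0 (R : realType) (w : nat -> R) (n : nat) (lambda : R) (q : nat)
    (k r : 'I_q -> nat) :
  wright_constants w -> 0 <= L_limit w n lambda k r.
Proof.
move=> hw; rewrite /L_limit /m_density !mulr_ge0 ?powR_ge0 ?expR_ge0 //.
apply: prodr_ge0 => i _; rewrite /rho !mulr_ge0 ?powR_ge0 ?invr_ge0 ?sqrtr_ge0 //.
by apply: ltW; have [] := hw (r i).
Qed.

Theorem proposition3p4 (R : realType) (w : nat -> R)
    (hw : wright_constants w) (q : nat) (hq : (1 <= q)%N)
    (r : 'I_q -> nat) (a b : R) (ha : 0 < a) (hab : a < b) :
  (forall lambda : R,
     forall eps : R, 0 < eps ->
     \forall n \near \oo, forall k : 'I_q -> nat,
       (forall i, a <= rescaled R n (k i) <= b) ->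
       `|L n lambda k r - L_limit w n lambda k r|
         <= eps * L_limit w n lambda k r)
  /\
  (forall lambda1 lambda2 : R, lambda1 <= lambda2 ->
     forall eps : R, 0 < eps ->
     \forall n \near \oo, forall lambda : R, lambda1 <= lambda <= lambda2 ->
     forall k : 'I_q -> nat,
       (forall i, a <= rescaled R n (k i) <= b) ->
       `|L n lambda k r - L_limit w n lambda k r|
         <= eps * L_limit w n lambda k r).
Proof.
have unif (lambda1 lambda2 : R) : lambda1 <= lambda2 ->
    forall eps : R, 0 < eps ->
    \forall n \near \oo, forall lambda : R, lambda1 <= lambda <= lambda2 ->
    forall k : 'I_q -> nat, (forall i, a <= rescaled R n (k i) <= b) ->
    `|L n lambda k r - L_limit w n lambda k r| <= eps * L_limit w n lambda k r.
  move=> l12 eps eps0.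
  pose eta : R := Num.min (1 / 2) (eps / 2).
  have eta0 : 0 < eta by rewrite lt_min; apply/andP; split; lra.
  have eta2 : eta <= 1 / 2 by rewrite ge_min lexx.
  have etae : eta <= eps / 2 by rewrite ge_min lexx orbT.
  have Lam0 : 0 <= `|lambda1| + `|lambda2| by rewrite addr_ge0.
  apply: filterS (L_eq_limit_expR r hw hq ha hab Lam0 eta0) => n Hn lambda.
  move=> /andP[l1 l2] k kab; have lL : `|lambda| <= `|lambda1| + `|lambda2|.
    have := ler_norm lambda2; have := ler_norm (- lambda1); rewrite normrN.
    have := normr_ge0 lambda1; have := normr_ge0 lambda2.
    by rewrite ler_norml => *; apply/andP; split; lra.
  have [y yle ->] := Hn lambda k lL kab.
  rewrite -[X in _ - X]mulr1 -mulrBr normrM ger0_norm ?L_limit_ge0 // mulrC.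
  apply: ler_wpM2r; first exact: L_limit_ge0.
  by apply: le_trans (expR_sub1_le (le_trans yle eta2)) _; lra.
split; last exact: unif.
move=> lambda eps eps0.
apply: filterS (unif lambda lambda (lexx _) eps eps0) => n Hn k.
by apply: Hn; rewrite lexx.
Qed.
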